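(* Let $A\in\mathrm{GL}(2,\mathbb{R})$ with $|\det(A)|\ge 1$ and eigenvalues $\lambda_1,\lambda_2$, $|\lambda_1|\ge|\lambda_2|$. Let $\mathcal{L}=P\mathbb{Z}^2$ be a lattice in $\mathbb{R}^2$ with $P\in\mathrm{GL}(2,\mathbb{R})$. (a) If $|\lambda_1\lambda_2|=1$, then there exists no measurable $T\subset\mathbb{R}^2$ such that $T$ tiles translationally by $\mathcal{L}$ and multiplicatively by $A$. (b) If $|\lambda_1|>1$ and $|\lambda_2|\ge 1$, then there exists a measurable $T\subset\mathbb{R}^2$ such that $T$ tiles translationally by $\mathcal{L}$ and multiplicatively by $A$. (c) If $|\lambda_1\lambda_2|>1$ and $|\lambda_2|<1$, let $\mathbf{v}=[v_1,v_2]^T$ be an eigenvector of $P^{-1}AP$ for the eigenvalue $\lambda_2$. Then there exists a measurable $T\subset\mathbb{R}^2$ such that $T$ tiles translationally by $\mathcal{L}$ and multiplicatively by $A$ if and only if $v_1/v_2\in\mathbb{R}\setminus\mathbb{Q}$.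
   Context: A collection of measurable sets $\{T_j\}$ in $\mathbb{R}^d$ is a tiling of $\mathbb{R}^d$ if the sets are pairwise disjoint in Lebesgue measure (pairwise intersections have measure zero) and their union is $\mathbb{R}^d$ up to a set of measure zero. A measurable set $T\subset\mathbb{R}^d$ tiles translationally by $\mathcal{J}\subset\mathbb{R}^d$ if $\{T+\alpha:\alpha\in\mathcal{J}\}$ is a tiling of $\mathbb{R}^d$. For $A\in\mathrm{GL}(d,\mathbb{R})$, a measurable set $T$ tiles multiplicatively by $A$ if $\{A^nT:n\in\mathbb{Z}\}$ is a tiling of $\mathbb{R}^d$. In (c), the eigenvalues are necessarily real and the ratio $v_1/v_2$ does not depend on the choice of eigenvector; the condition $v_1/v_2\in\mathbb{R}\setminus\mathbb{Q}$ means that $v_2\neq 0$ and the ratio is irrational. *)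

(* Defs.v *)
From HB Require Import structures.
From mathcomp Require Import all_boot all_order all_algebra.
From mathcomp Require Import complex.
From mathcomp Require Import all_classical all_reals all_analysis.
From mathcomp Require Import measurable_realfun.

Set Implicit Arguments.
Unset Strict Implicit.
Unset Printing Implicit Defensive.

Import Order.TTheory GRing.Theory Num.Theory.
Import numFieldNormedType.Exports.

Local Open Scope classical_set_scope.
Local Open Scope ring_scope.

Section Plane.
Context {R : realType}.

Definition lebesgue_measure2 :
    set (measurableTypeR R * measurableTypeR R) -> \bar R :=
  (@lebesgue_measure R \x @lebesgue_measure R)%E.

(* The matrix library puts no measurable structure on 'cV[R]_2, so measure
   notions are transported along this bijection from R * R. *)
Definition vec2 (x : measurableTypeR R * measurableTypeR R) : 'cV[R]_2 :=
  \col_(i < 2) if i == 0 then x.1 else x.2.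

(* Lebesgue measurable rather than only Borel: completed_algebra_gen is the
   completion of the Borel sigma-algebra by subsets of null sets. *)
Definition measurable2 (S : set 'cV[R]_2) : Prop :=
  completed_algebra_gen lebesgue_measure2 (vec2 @^-1` S).

Definition negligible2 (N : set 'cV[R]_2) : Prop :=
  lebesgue_measure2.-negligible (vec2 @^-1` N).

(* The collection is an indexed family: repeated members count as distinct
   tiles. Otherwise the whole plane would tile by every set of translations. *)
Definition tiling (I : Type) (D : set I) (F : I -> set 'cV[R]_2) : Prop :=
  [/\ forall i, D i -> measurable2 (F i),
      forall i j, D i -> D j -> i <> j -> negligible2 (F i `&` F j)
    & negligible2 (~` \bigcup_(i in D) F i)].

Definition tiles_translationally (T J : set 'cV[R]_2) : Prop :=
  tiling J (fun alpha => [set x + alpha | x in T]).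

Definition tiles_multiplicatively (T : set 'cV[R]_2) (A : 'M[R]_2) : Prop :=
  tiling [set: int] (fun n : int => [set A ^ n *m x | x in T]).

Definition lattice (P : 'M[R]_2) : set 'cV[R]_2 :=
  [set P *m map_mx intr z | z in [set: 'cV[int]_2]].

Definition tiles_both (T : set 'cV[R]_2) (A P : 'M[R]_2) : Prop :=
  [/\ measurable2 T, tiles_translationally T (lattice P)
    & tiles_multiplicatively T A].

Definition complexify m n (M : 'M[R]_(m, n)) : 'M[R[i]]_(m, n) :=
  map_mx (real_complex R) M.

(* Listed with algebraic multiplicity. *)
Definition eigenvalues2 (A : 'M[R]_2) (lambda1 lambda2 : R[i]) : Prop :=
  char_poly (complexify A) = ('X - lambda1%:P) * ('X - lambda2%:P).

(* A right (column) eigenvector; mathcomp's eigenspace is about rows. *)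
Definition eigenvector (M : 'M[R]_2) (lambda : R[i]) (v : 'cV[R[i]]_2) : Prop :=
  v != 0 /\ complexify M *m v = lambda *: v.

End Plane.

(* Main.v *)
(** A set tiles translationally when it meets every orbit of the lattice group G
once, and multiplicatively when it meets every orbit of the group H generated by
A once, up to null sets.

Existence. A Cantor-Bernstein exchange turns a set U that is a tile for H and
packs for G, and a set V that is a tile for G and packs for H, into a common
tile. If l is a complex left eigenvector for lambda1, the annulus
{1 <= |l x| < |lambda1|} is an H-tile; a fundamental domain of the lattice
translated far away fits in a scaled annulus, which gives V. For U, cut the
annulus into small pieces D_s, each repeated infinitely often, and push D_s to
A^(-n_s) D_s with n_s growing fast. Since |det A| > 1, each of these is far
smaller than the previous ones, so it can have priority over them: the part of
D_s lost this way has summable measure, and by Borel-Cantelli almost every point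
of the annulus survives at some step. This only needs that A^(-n) D_s packs for
the lattice for arbitrarily large n, i.e. that A^n P Z^2 has no short nonzero
vector: clear when A^(-1) has bounded powers, and for a saddle a consequence of
the irrationality of the contracted direction.

Nonexistence. If |det A| = 1, the tiles T and 2T of H have the same measure,
which is positive and finite because T tiles by the lattice. If the contracted
direction contains a lattice vector, T meets the strip {|lambda1|^(-n) <= |l| <
|lambda1|^(1-n)} in measure O(|lambda1|^(-n)), whose image under A^n has
measure O(|lambda2|^n); so the sets A^n T cannot cover the strip
{1 <= |l| < |lambda1|}, of infinite measure. *)

Require Import Defs.
From HB Require Import structures.
From mathcomp Require Import all_boot all_order all_algebra.
From mathcomp Require Import complex.
From mathcomp Require Import all_classical all_reals all_analysis.
From mathcomp Require Import measurable_realfun ring lra zify.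

Set Implicit Arguments.
Unset Strict Implicit.
Unset Printing Implicit Defensive.

Import Order.TTheory GRing.Theory Num.Theory.
Import numFieldNormedType.Exports.

Local Open Scope classical_set_scope.
Local Open Scope ring_scope.

(** * Linear maps and Lebesgue measure of the plane *)

Section LebesgueLine.
Context {R : realType}.
Local Notation leb := (@lebesgue_measure R).

Lemma lebesgue_measure_translate (c : R) (S : set (measurableTypeR R)) :
  measurable S -> leb ((fun x : R => x + c) @^-1` S) = leb S.
Proof.
move=> mS; apply/esym.
have mf : measurable_fun setT ((fun x : R => x + c) : measurableTypeR R -> measurableTypeR R).
  exact: measurable_funD.
have := @lebesgue_measure_unique R (pushforward leb (fun x : R => x + c : measurableTypeR R)).
apply => //= _ [[a b]] _ <-.
rewrite /pushforward.
have -> : (fun x : R => x + c) @^-1` `]a, b] = `](a - c), (b - c)]%classic.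
  by apply/seteqP; split => x /=; rewrite !in_itv/= ltrBlDr lerBrDr.
rewrite !lebesgue_measure_itv /= !lte_fin ltrBlDr subrK.
by case: ifP => // _; rewrite -!EFinB; congr EFin; ring.
Qed.

Lemma lebesgue_measure_scale (c : R) (S : set (measurableTypeR R)) :
  c != 0 -> measurable S ->
  (leb ((fun x : R => (c * x)%R) @^-1` S) * `|c|%:E = leb S)%E.
Proof.
move=> c0 mS; apply/esym.
have mf : measurable_fun setT ((fun x : R => c * x) : measurableTypeR R -> measurableTypeR R).
  exact: measurable_funM.
have := @lebesgue_measure_unique R
  (mscale (NngNum (normr_ge0 c)) (pushforward leb (fun x : R => c * x : measurableTypeR R))).
rewrite muleC; apply => //= _ [[a b]] _ <-.
rewrite /mscale /= /pushforward.
have [cp|cn|/esym/eqP] := ltrgtP 0 c; last by rewrite (negbTE c0).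
  rewrite (_ : _ @^-1` _ = `](a / c), (b / c)]%classic); last first.
    by apply/seteqP; split => x /=; rewrite !in_itv/= ltr_pdivrMr// ler_pdivlMr// mulrC.
  rewrite !lebesgue_measure_itv /= !lte_fin ltr_pM2r ?invr_gt0//.
  case: ifP => // _; rewrite ?mule0// -!EFinB -EFinM; congr EFin.
  by rewrite gtr0_norm//; field.
(* A negative factor exchanges the endpoints, so the preimage is half-open on the other side. *)
rewrite (_ : _ @^-1` _ = `[(b / c), (a / c)[%classic); last first.
  apply/seteqP; split => x /=; rewrite !in_itv/= ltr_ndivlMr// ler_ndivrMr// mulrC;
  by rewrite andbC.
rewrite !lebesgue_measure_itv /= !lte_fin ltr_nM2r ?invr_lt0//.
case: ifP => // _; rewrite ?mule0// -!EFinB -EFinM; congr EFin.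
by rewrite ltr0_norm//; field.
Qed.
End LebesgueLine.

Section PlaneMeasure.
Context {R : realType}.
Local Notation leb := (@lebesgue_measure R).
Local Notation mu := (@lebesgue_measure2 R).
Local Notation pt := (measurableTypeR R * measurableTypeR R)%type.

Lemma measurable_pair_fun d (T : measurableType d) (f g : T -> measurableTypeR R) :
  measurable_fun setT f -> measurable_fun setT g ->
  measurable_fun setT (fun x => (f x, g x) : pt).
Proof. exact: measurable_fun_pair. Qed.

(** Both orders of iterated integration define the same product measure. *)
Lemma lebesgue_measure2_swap (X : set pt) : measurable X ->
  mu ((fun x : pt => (x.2, x.1) : pt) @^-1` X) = mu X.
Proof.
move=> mX.
have -> : mu X = (leb \x^ leb)%E X.
  by apply: product_measure_unique => //= ? ? ? ?; rewrite product_measure2E.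
rewrite /lebesgue_measure2 /product_measure1 /product_measure2.
by apply: eq_integral => x _ /=; congr (leb _).
Qed.

(** The map translates each vertical section, and the measure integrates the lengths of the
    sections. *)
Lemma lebesgue_measure2_shear (g : measurableTypeR R -> R) (X : set pt) :
  measurable_fun setT g -> measurable X ->
  mu ((fun x : pt => (x.1, (x.2 : R) + g x.1) : pt) @^-1` X) = mu X.
Proof.
move=> mg mX; rewrite /lebesgue_measure2 /product_measure1.
apply: eq_integral => x _ /=.
rewrite -(lebesgue_measure_translate (g x) (measurable_xsection x mX)).
by congr (leb _).
Qed.

Lemma lebesgue_measure2_scale (c : R) (X : set pt) :
  c != 0 -> measurable X ->
  (mu ((fun x : pt => (x.1, (c * x.2)%R) : pt) @^-1` X) * `|c|%:E = mu X)%E.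
Proof.
move=> c0 mX; rewrite /lebesgue_measure2 /product_measure1.
have mf : measurable_fun setT (fun x : pt => (x.1, (c * x.2)%R) : pt).
  by apply: measurable_pair_fun => //; apply: measurable_funM.
have mY : measurable ((fun x : pt => (x.1, (c * x.2)%R) : pt) @^-1` X).
  by rewrite -[X in measurable X]setTI; exact: mf.
rewrite -ge0_integralZr//; last first.
  exact: measurable_fun_xsection.
apply: eq_integral => x _ /=.
rewrite -(lebesgue_measure_scale c0 (measurable_xsection x mX)).
by congr (leb _ * _)%E.
Qed.

Definition lact (M : 'M[R]_2) (x : pt) : pt :=
  (M 0 0 * x.1 + M 0 1 * x.2, M 1 0 * x.1 + M 1 1 * x.2).

Definition translate (a : 'cV[R]_2) (x : pt) : pt := (x.1 + a 0 0, x.2 + a 1 0).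

Lemma eq_mx2 (T : Type) (m : nat) (M N : 'M[T]_(2, m)) :
  (forall j, M 0 j = N 0 j) -> (forall j, M 1 j = N 1 j) -> M = N.
Proof.
move=> h0 h1; apply/matrixP => i j.
by case: i => -[|[|//]] i2; [have -> : Ordinal i2 = 0 by apply/val_inj|
  have -> : Ordinal i2 = 1 by apply/val_inj].
Qed.

Lemma mulmx2E (K : pzSemiRingType) (m n : nat) (M : 'M[K]_(m, 2)) (N : 'M[K]_(2, n)) i j :
  (M *m N) i j = M i 0 * N 0 j + M i 1 * N 1 j.
Proof.
by rewrite mxE !big_ord_recl big_ord0 addr0 (_ : lift _ _ = 1)//; exact/val_inj.
Qed.

Lemma vec2_lact M x : vec2 (lact M x) = M *m vec2 x.
Proof.
by apply: eq_mx2 => j; rewrite ord1 mulmx2E !mxE.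
Qed.

Lemma vec2_translate a x : vec2 (translate a x) = vec2 x + a.
Proof. by apply: eq_mx2 => j; rewrite ord1 !mxE. Qed.

Lemma vec2_inj : injective (@vec2 R).
Proof.
move=> [x1 x2] [y1 y2] /matrixP e.
by have := e 0 0; have := e 1 0; rewrite !mxE /= => -> ->.
Qed.

Lemma lact_mul M N x : lact (M *m N) x = lact M (lact N x).
Proof. by apply: vec2_inj; rewrite !vec2_lact mulmxA. Qed.

Lemma lact1 x : lact 1%:M x = x.
Proof. by apply: vec2_inj; rewrite !vec2_lact mul1mx. Qed.

Lemma measurable_lact M : measurable_fun setT (lact M).
Proof.
by apply: measurable_pair_fun; apply: measurable_funD; apply: measurable_funM.
Qed.

Lemma measurable_translate a : measurable_fun setT (translate a).
Proof. by apply: measurable_pair_fun; apply: measurable_funD. Qed.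

Lemma measurable_preim (f : pt -> pt) X :
  measurable_fun setT f -> measurable X -> measurable (f @^-1` X).
Proof. by move=> mf mX; rewrite -[X in measurable X]setTI; exact: mf. Qed.

Lemma lebesgue_measure2_translate a X : measurable X ->
  mu (translate a @^-1` X) = mu X.
Proof.
move=> mX.
pose s (x : pt) : pt := (x.2, x.1).
pose t c (x : pt) : pt := (x.1, (x.2 : R) + c).
have ms : measurable_fun setT s by apply: measurable_pair_fun.
have mt c : measurable_fun setT (t c).
  by apply: measurable_pair_fun => //; apply: measurable_funD.
have -> : translate a @^-1` X = t (a 1 0) @^-1` (s @^-1` (t (a 0 0) @^-1` (s @^-1` X))).
  by [].
have mX1 := measurable_preim ms mX.
have mX2 := measurable_preim (mt (a 0 0)) mX1.
have mX3 := measurable_preim ms mX2.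
have mc c : measurable_fun setT (fun _ : measurableTypeR R => c : R) by [].
transitivity (mu (s @^-1` (t (a 0 0) @^-1` (s @^-1` X)))).
  exact: (lebesgue_measure2_shear (mc (a 1 0)) mX3).
transitivity (mu (t (a 0 0) @^-1` (s @^-1` X))); first exact: lebesgue_measure2_swap.
transitivity (mu (s @^-1` X)); last exact: lebesgue_measure2_swap.
exact: (lebesgue_measure2_shear (mc (a 0 0)) mX1).
Qed.

Let scales (M : 'M[R]_2) := forall X : set pt, measurable X ->
  (mu (lact M @^-1` X) * `|\det M|%:E = mu X)%E.

Let mx2 (a b c d : R) : 'M[R]_2 :=
  \matrix_(i, j) if i == 0 then (if j == 0 then a else b)
                 else (if j == 0 then c else d).

Lemma det_mx2 (M : 'M[R]_2) : \det M = M 0 0 * M 1 1 - M 0 1 * M 1 0.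
Proof.
rewrite (expand_det_row _ 0) !big_ord_recl big_ord0 addr0.
rewrite /cofactor !det_mx11 !mxE /= expr0 expr1 mul1r.
rewrite (_ : lift 0 0 = 1); last exact/val_inj.
rewrite (_ : lift 1 0 = 0); last exact/val_inj.
ring.
Qed.

Let scales_mul M N : scales M -> scales N -> scales (M *m N).
Proof.
move=> sM sN X mX.
rewrite (_ : _ @^-1` _ = lact N @^-1` (lact M @^-1` X)); last first.
  by apply/seteqP; split => x /=; rewrite lact_mul.
rewrite det_mulmx normrM mulrC EFinM muleA sN ?sM//.
exact: (measurable_preim (measurable_lact M)).
Qed.

Let scales_swap : scales (mx2 0 1 1 0).
Proof.
move=> X mX; rewrite det_mx2 !mxE /= mul0r mulr1 sub0r normrN normr1 mule1.
rewrite -(lebesgue_measure2_swap mX); congr (mu _).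
by apply/seteqP; split => -[x y] /=; rewrite /lact !mxE /= !mul0r !mul1r add0r addr0.
Qed.

Let scales_diag c : c != 0 -> scales (mx2 1 0 0 c).
Proof.
move=> c0 X mX; rewrite det_mx2 !mxE /= mul0r mul1r subr0.
rewrite -(lebesgue_measure2_scale c0 mX); congr (mu _ * _)%E.
by apply/seteqP; split => -[x y] /=; rewrite /lact !mxE /= !mul0r !mul1r add0r addr0.
Qed.

Let scales_shear c : scales (mx2 1 0 c 1).
Proof.
move=> X mX; rewrite det_mx2 !mxE /= mul0r mul1r subr0 normr1 mule1.
have mf : measurable_fun setT ((fun x : R => c * x) : measurableTypeR R -> R).
  exact: measurable_funM.
rewrite -(lebesgue_measure2_shear mf mX); congr (mu _).
by apply/seteqP; split => -[x y] /=; rewrite /lact !mxE /= !mul0r !mul1r addr0 addrC.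
Qed.

(** Row reduction: a matrix with nonzero corner entry is a product of shears, diagonal matrices and
    coordinate swaps. The rule holds for these by integrating over sections, and it is stable under
    products. *)
Lemma lebesgue_measure2_lact (M : 'M[R]_2) (X : set pt) : M \in unitmx ->
  measurable X -> (mu (lact M @^-1` X) * `|\det M|%:E = mu X)%E.
Proof.
rewrite unitmxE unitfE => dM; suff sM : scales M by exact: sM.
pose S := mx2 0 1 1 0.
have scales_ushear c : scales (mx2 1 c 0 1).
  have -> : mx2 1 c 0 1 = S *m mx2 1 0 c 1 *m S.
    by apply: eq_mx2 => -[[|[|?]] ?] //; rewrite !mulmx2E !mxE /=; ring.
  exact: (scales_mul (scales_mul scales_swap (scales_shear c)) scales_swap).
have gauss a b c d : a != 0 -> a * d - b * c != 0 -> scales (mx2 a b c d).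
  move=> a0 D0.
  have -> : mx2 a b c d = mx2 1 0 (c / a) 1 *m (S *m mx2 1 0 0 a *m S)
      *m mx2 1 0 0 ((a * d - b * c) / a) *m mx2 1 (b / a) 0 1.
    by apply: eq_mx2 => -[[|[|?]] ?] //; rewrite !mulmx2E !mxE /=; field.
  have Da0 : (a * d - b * c) / a != 0 by rewrite mulf_neq0 ?invr_eq0.
  exact: (scales_mul (scales_mul (scales_mul (scales_shear _) (scales_mul (scales_mul
    scales_swap (scales_diag a0)) scales_swap)) (scales_diag Da0)) (scales_ushear _)).
have eM : M = mx2 (M 0 0) (M 0 1) (M 1 0) (M 1 1).
  apply: eq_mx2 => -[[|[|?]] ?] //; rewrite !mxE /=; congr (M _ _); exact/val_inj.
rewrite det_mx2 in dM.
have [a0|a0] := eqVneq (M 0 0) 0; last by rewrite eM; exact: gauss.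
(* With a zero corner entry, exchanging the rows brings the nonzero [M 1 0] there. *)
have c0 : M 1 0 != 0 by apply: contraNneq dM => c0; rewrite a0 c0; apply/eqP; ring.
have -> : M = S *m mx2 (M 1 0) (M 1 1) (M 0 0) (M 0 1).
  rewrite {1}eM; apply: eq_mx2 => -[[|[|?]] ?] //; rewrite !mulmx2E !mxE /=; ring.
apply: (scales_mul scales_swap); apply: gauss => //.
by rewrite -oppr_eq0 (_ : - _ = M 0 0 * M 1 1 - M 0 1 * M 1 0) //; ring.
Qed.
End PlaneMeasure.

(** * Packings and coverings *)

HB.instance Definition _ (R : realType) := Measure.on (@lebesgue_measure2 R).

Section Packing.
Local Open Scope ereal_scope.
Context d (T : measurableType d) (R : realType) (mu : {measure set T -> \bar R}).

Lemma le_measure_negligible (A B : set T) : measurable A -> measurable B ->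
  mu.-negligible (A `\` B) -> mu A <= mu B.
Proof.
move=> mA mB [N [mN N0 ABN]].
rewrite -[leRHS]adde0 -N0 (le_trans _ (measureU2 mu mB mN))//.
apply: le_measure; rewrite ?inE//; first exact: measurableU.
by move=> x Ax; have [Bx|nBx] := pselect (B x); [left|right; exact: ABN].
Qed.

Lemma negligible_bigcup_count (I : countType) (F : I -> set T) :
  (forall i, mu.-negligible (F i)) -> mu.-negligible (\bigcup_i F i).
Proof.
move=> nF.
have := @negligible_bigcup _ _ _ mu (fun n => oapp F set0 (unpickle n)).
move=> /(_ _)/negligibleS; apply.
  by move=> x [i _ Fx]; exists (pickle i) => //; rewrite pickleK.
by move=> n; case: unpickle => //=; exact: negligible_set0.
Qed.

(* X `&` h_i @^-1` Y has the measure of g_i @^-1` X `&` Y, and the latter sets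
   are almost disjoint parts of Y. *)
Lemma packing_le_covering (I : countType) (g h : I -> T -> T) (X Y : set T) :
  (forall i, measurable_fun setT (g i)) ->
  (forall i, measurable_fun setT (h i)) ->
  (forall i S, measurable S -> mu (g i @^-1` S) = mu S) ->
  (forall i, cancel (g i) (h i)) ->
  measurable X -> measurable Y ->
  (forall i j, i <> j -> mu.-negligible (g i @^-1` X `&` g j @^-1` X)) ->
  mu.-negligible (X `\` \bigcup_i h i @^-1` Y) ->
  mu X <= mu Y.
Proof.
move=> mg mh gmu gh mX mY dX cX.
have mpre (f : T -> T) S : measurable_fun setT f -> measurable S -> measurable (f @^-1` S).
  by move=> mf mS; rewrite -[X in measurable X]setTI; exact: mf.
(* [pickle_inv] decodes only genuine codes, so distinct numbers never give the same index; the other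
   numbers give the empty set. *)
pose F n := oapp (fun i => g i @^-1` X `&` Y) set0 (pickle_inv (T:=I) n).
pose G n := oapp (fun i => X `&` h i @^-1` Y) set0 (pickle_inv (T:=I) n).
have mF n : measurable (F n).
  by rewrite /F; case: pickle_inv => //= i; apply: measurableI => //; exact: mpre.
have mG n : measurable (G n).
  by rewrite /G; case: pickle_inv => //= i; apply: measurableI => //; exact: mpre.
have FG n : mu (F n) = mu (G n).
  rewrite /F /G; case: pickle_inv => //= i.
  rewrite -[RHS](gmu i); last by apply: measurableI => //; exact: mpre.
  congr (mu _); apply/seteqP; split => x /=; rewrite gh//.
(* The overlaps among the [F n] are null, so making them disjoint keeps every measure. *)
have FD n : mu (F n) = mu (seqDU F n).
  have mD : measurable (seqDU F n).
    by apply: measurableD => //; exact: bigsetU_measurable.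
  apply/eqP; rewrite eq_le; apply/andP; split; last first.
    by apply: le_measure; rewrite ?inE//; exact: subDsetl.
  apply: le_measure_negligible => //.
  apply: (@negligibleS _ _ _ _ (\bigcup_m if m == n then set0 else F n `&` F m)).
    move=> x [Fx]; rewrite /seqDU /= => /not_andP[//|/contrapT].
    rewrite -bigcup_mkord => -[m /= mn Fmx]; exists m => //.
    by rewrite (ltn_eqF mn).
  apply: negligible_bigcup => m; case: eqVneq => [_|/eqP mn].
    exact: negligible_set0.
  rewrite /F; case en : (pickle_inv n) => [i|] /=; last first.
    by rewrite set0I; exact: negligible_set0.
  case em : (pickle_inv m) => [j|] /=; last first.
    by rewrite setI0; exact: negligible_set0.
  have /dX : i <> j.
    move=> ij; apply: mn; move: (pickle_invK (T:=I) n) (pickle_invK (T:=I) m).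
    by rewrite en em /= ij => -> ->.
  by apply: negligibleS => x [[? _] [? _]].
have XG : mu X <= mu (\bigcup_n G n).
  apply: le_measure_negligible => //; first exact: bigcupT_measurable.
  apply: negligibleS cX => x [Xx nGx]; split => // -[i _ hx]; apply: nGx.
  by exists (pickle i) => //; rewrite /G pickleK_inv.
apply: (le_trans XG).
apply: (@le_trans _ _ (\sum_(n <oo) mu (G n))).
  by apply: measure_sigma_subadditive => //; exact: bigcupT_measurable.
under eq_eseriesr do rewrite -FG FD.
have mD n : measurable (seqDU F n).
  by apply: measurableD => //; exact: bigsetU_measurable.
have mDU : measurable (\bigcup_n seqDU F n) by exact: bigcupT_measurable.
rewrite -(measure_semi_bigcup mu mD (@trivIset_seqDU _ F) mDU).
apply: le_measure; rewrite ?inE//.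
move=> x [n _ [Fx _]]; move: Fx; rewrite /F.
by case: pickle_inv => //= i [].
Qed.

End Packing.

(** * The Cantor-Bernstein exchange *)

Section CantorBernstein.
Variables (X : Type) (eqG eqH : X -> X -> Prop).
Hypothesis eqG_sym : forall x y, eqG x y -> eqG y x.
Hypothesis eqG_trans : forall x y z, eqG x y -> eqG y z -> eqG x z.
Hypothesis eqH_sym : forall x y, eqH x y -> eqH y x.
Hypothesis eqH_trans : forall x y z, eqH x y -> eqH y z -> eqH x z.

Definition saturation (e : X -> X -> Prop) (S : set X) : set X :=
  [set x | exists2 y, S y & e x y].

Definition packs (e : X -> X -> Prop) (S : set X) :=
  forall x y, S x -> S y -> e x y -> x = y.

Variables U V : set X.

(* The points of V that cannot be traded for points of U along alternating
   eqG/eqH chains. *)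
Fixpoint chain (i : nat) : set X :=
  if i is j.+1 then V `&` saturation eqG (U `&` saturation eqH (chain j))
  else V `\` saturation eqG U.

(** Chain points of [V] must be kept; each replaces the point of [U] in its [eqH]-class, if there is
    one. *)
Definition exchange : set X :=
  (\bigcup_i chain i) `|` (U `\` saturation eqH (\bigcup_i chain i)).

Let chainV i : chain i `<=` V.
Proof. by case: i => [|i] x []. Qed.

Hypotheses (packGU : packs eqG U) (packHU : packs eqH U).
Hypotheses (packGV : packs eqG V) (packHV : packs eqH V).

(** A kept [u] in [U] is never [eqG]-related to a chain point [v]: at level 0 by definition, later
    because [v] was reached through a dropped point of [U], which packing would identify with
    [u]. *)
Lemma exchange_packs_l : packs eqG exchange.
Proof.
have cross v u : (\bigcup_i chain i) v -> U u ->
    ~ saturation eqH (\bigcup_i chain i) u -> eqG v u -> False.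
  move=> [[|i] _ /= []] Vv; first by move=> nU Uu _ vu; apply: nU; exists u.
  move=> [u' [Uu' [w cw u'w]] vu'] Uu nu vu; apply: nu; exists w; first by exists i.
  by rewrite (packGU Uu Uu' (eqG_trans (eqG_sym vu) vu')).
move=> x y [cx|[Ux nx]] [cy|[Uy ny]] xy.
- case: cx => i _ /chainV Vx; case: cy => j _ /chainV Vy; exact: packGV.
- by case: (cross _ _ cx Uy ny xy).
- by case: (cross _ _ cy Ux nx (eqG_sym xy)).
- exact: packGU.
Qed.

Lemma exchange_packs_r : packs eqH exchange.
Proof.
move=> x y [cx|[Ux nx]] [cy|[Uy ny]] xy.
- case: cx => i _ /chainV Vx; case: cy => j _ /chainV Vy; exact: packHV.
- by case: ny; exists x => //; exact: eqH_sym.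
- by case: nx; exists y.
- exact: packHU.
Qed.

(** A point [v] of [V] outside the chain is [eqG]-related to some [u] in [U]; were [u] dropped, [v]
    would enter the chain at the next level. *)
Lemma exchange_saturation_l : (forall x, saturation eqG V x) ->
  forall x, saturation eqG exchange x.
Proof.
move=> coverV x; have [v Vv xv] := coverV x.
have [cv|ncv] := pselect ((\bigcup_i chain i) v); first by exists v => //; left.
have [[u Uu vu]|nv] := pselect (saturation eqG U v); last first.
  by case: ncv; exists 0%N.
exists u; last exact: eqG_trans vu.
right; split => // -[w [i _ cw] uw]; apply: ncv; exists i.+1 => //=.
by split => //; exists u => //; split => //; exists w.
Qed.

Lemma exchange_saturation_r : saturation eqH U `<=` saturation eqH exchange.
Proof.
move=> x [u Uu xu].
have [[w cw uw]|nu] := pselect (saturation eqH (\bigcup_i chain i) u).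
  by exists w; [left|exact: eqH_trans uw].
by exists u => //; right.
Qed.

End CantorBernstein.

(** * The lattice and dilation actions *)

Section Actions.
Context {R : realType}.
Local Notation mu := (@lebesgue_measure2 R).
Local Notation pt := (measurableTypeR R * measurableTypeR R)%type.
Implicit Types (A P : 'M[R]_2) (a b : 'cV[R]_2) (x y : pt).

Lemma translateD a b x : translate a (translate b x) = translate (b + a) x.
Proof. by apply: vec2_inj; rewrite !vec2_translate addrA. Qed.

Lemma translate0 x : translate 0 x = x.
Proof. by apply: vec2_inj; rewrite vec2_translate addr0. Qed.

Lemma lact_translate A a x : lact A (translate a x) = translate (A *m a) (lact A x).
Proof. by apply: vec2_inj; rewrite !(vec2_lact, vec2_translate) mulmxDr. Qed.

Definition lattice_pt P (z : 'cV[int]_2) : 'cV[R]_2 := P *m map_mx intr z.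

Lemma lattice_ptD P (y z : 'cV[int]_2) : lattice_pt P (y + z) = lattice_pt P y + lattice_pt P z.
Proof. by rewrite /lattice_pt map_mxD mulmxDr. Qed.

Lemma lattice_ptN P (z : 'cV[int]_2) : lattice_pt P (- z) = - lattice_pt P z.
Proof. by rewrite /lattice_pt map_mxN mulmxN. Qed.

Lemma lattice_pt0 P : lattice_pt P 0 = 0.
Proof. by rewrite /lattice_pt map_mx0 mulmx0. Qed.

Lemma lattice_pt_inj P : P \in unitmx -> injective (lattice_pt P).
Proof.
move=> uP y z /(congr1 (mulmx (invmx P))); rewrite !mulKmx// => /matrixP e.
by apply/matrixP => i j; have := e i j; rewrite !mxE => /intr_inj.
Qed.

Definition eq_lattice P x y := exists z, y = translate (lattice_pt P z) x.
Definition eq_dilation A x y := exists n : int, y = lact (A ^ n) x.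

Lemma eq_lattice_sym P x y : eq_lattice P x y -> eq_lattice P y x.
Proof.
by move=> [z ->]; exists (- z); rewrite translateD lattice_ptN subrr translate0.
Qed.

Lemma eq_lattice_trans P x y z :
  eq_lattice P x y -> eq_lattice P y z -> eq_lattice P x z.
Proof. by move=> [a ->] [b ->]; exists (a + b); rewrite translateD lattice_ptD. Qed.

Lemma lact_expDz A (m n : int) x : A \in unitmx ->
  lact (A ^ (m + n)) x = lact (A ^ m) (lact (A ^ n) x).
Proof. by move=> uA; rewrite exprzDr// -lact_mul. Qed.

Lemma lact_expK A (n : int) x : A \in unitmx -> lact (A ^ (- n)) (lact (A ^ n) x) = x.
Proof. by move=> uA; rewrite -lact_expDz// addNr expr0z lact1. Qed.

Lemma lact_expNK A (n : int) x : A \in unitmx -> lact (A ^ n) (lact (A ^ (- n)) x) = x.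
Proof. by move=> uA; rewrite -lact_expDz// addrN expr0z lact1. Qed.

Lemma eq_dilation_sym A x y : A \in unitmx -> eq_dilation A x y -> eq_dilation A y x.
Proof. by move=> uA [n ->]; exists (- n); rewrite lact_expK. Qed.

Lemma eq_dilation_trans A x y z : A \in unitmx ->
  eq_dilation A x y -> eq_dilation A y z -> eq_dilation A x z.
Proof. by move=> uA [m ->] [n ->]; exists (n + m); rewrite lact_expDz. Qed.

Lemma saturation_latticeE P (S : set pt) :
  saturation (eq_lattice P) S = \bigcup_z (translate (lattice_pt P z) @^-1` S).
Proof.
apply/seteqP; split => x.
  by move=> [y Sy [z yz]]; exists z => //=; rewrite -yz.
by move=> [z _ Sz]; exists (translate (lattice_pt P z) x) => //; exists z.
Qed.

Lemma saturation_dilationE A (S : set pt) :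
  saturation (eq_dilation A) S = \bigcup_n (lact (A ^ n) @^-1` S).
Proof.
apply/seteqP; split => x.
  by move=> [y Sy [z yz]]; exists z => //=; rewrite -yz.
by move=> [z _ Sz]; exists (lact (A ^ z) x) => //; exists z.
Qed.

Lemma measurable_saturation_lattice P (S : set pt) :
  measurable S -> measurable (saturation (eq_lattice P) S).
Proof.
move=> mS; rewrite saturation_latticeE; apply: countable_bigcupT_measurable => // z.
exact: measurable_preim (measurable_translate _) mS.
Qed.

Lemma measurable_saturation_dilation A (S : set pt) :
  measurable S -> measurable (saturation (eq_dilation A) S).
Proof.
move=> mS; rewrite saturation_dilationE; apply: countable_bigcupT_measurable => // n.
exact: measurable_preim (measurable_lact _) mS.
Qed.

Lemma det_expr A (n : nat) : \det (A ^+ n) = \det A ^+ n.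
Proof. by elim: n => [|n IH]; rewrite ?expr0 ?det1// !exprS -IH det_mulmx. Qed.

Lemma det_expz A (n : int) : \det (A ^ n) = \det A ^ n.
Proof.
case: n => n; first exact: det_expr.
by rewrite /exprz -[X in \det X]/(invmx (A ^+ n.+1)) det_inv det_expr.
Qed.

Lemma unitmx_expz A (n : int) : A \in unitmx -> A ^ n \in unitmx.
Proof. by move=> uA; rewrite -[_ \in _]/(_ \is a GRing.unit) unitrXz. Qed.

Lemma negligible_lact A (N : set pt) : A \in unitmx ->
  mu.-negligible N -> mu.-negligible (lact A @^-1` N).
Proof.
move=> uA [B [mB B0 NB]]; exists (lact A @^-1` B); split.
- exact: measurable_preim (measurable_lact _) mB.
- have := lebesgue_measure2_lact uA mB; rewrite B0 => /eqP.
  rewrite mule_eq0 => /orP[/eqP//|]; rewrite eqe normr_eq0 => d0.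
  by move: uA; rewrite unitmxE unitfE d0.
- by move=> x /NB.
Qed.

Lemma negligible_translate a (N : set pt) :
  mu.-negligible N -> mu.-negligible (translate a @^-1` N).
Proof.
move=> [B [mB B0 NB]]; exists (translate a @^-1` B); split.
- exact: measurable_preim (measurable_translate _) mB.
- by rewrite lebesgue_measure2_translate.
- by move=> x /NB.
Qed.
End Actions.

(** * A dilation tile packing for the lattice *)

(** Bernoulli's inequality. *)
Lemma expr_unbounded (R : realType) (a K : R) : 1 < a ->
  exists n0, forall n, (n0 <= n)%N -> K <= a ^+ n.
Proof.
move=> a1; have bern n : 1 + n%:R * (a - 1) <= a ^+ n.
  elim: n => [|n IH]; first by rewrite mul0r addr0 expr0.
  rewrite exprS -natr1; apply: le_trans (ler_wpM2l (ltW (lt_trans ltr01 a1)) IH).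
  rewrite -subr_ge0 (_ : _ - _ = n%:R * (a - 1) ^+ 2); last by ring.
  by rewrite mulr_ge0 ?sqr_ge0.
exists (Num.bound `|K / (a - 1)|) => n /= hn.
apply: le_trans (bern n); rewrite -[leLHS]add0r lerD//.
rewrite -ler_pdivrMr ?subr_gt0//; apply: le_trans (_ : (Num.bound `|K / (a - 1)|)%:R <= _).
  by apply/ltW/(le_lt_trans (ler_norm _)); exact/archi_boundP/normr_ge0.
by rewrite ler_nat.
Qed.

Section MultiscaleTile.
Context {R : realType}.
Local Notation mu := (@lebesgue_measure2 R).
Local Notation pt := (measurableTypeR R * measurableTypeR R)%type.
Variables (A P : 'M[R]_2) (D : set pt) (delta : R).
Hypotheses (uP : P \in unitmx) (uA : A \in unitmx) (detA : 1 < `|\det A|).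
Hypotheses (mD : measurable D) (packD : packs (eq_dilation A) D)
  (coverD : mu.-negligible (~` saturation (eq_dilation A) D)).

(** At a good scale, [A ^+ n] takes no nonzero lattice vector into the open square of half-side
    [delta], so the preimage of a cell of side [delta] packs for the lattice. *)
Let good (n : nat) := forall z : 'cV[int]_2, z != 0 ->
  ~ (`|(A ^+ n *m lattice_pt P z) 0 0| < delta /\
     `|(A ^+ n *m lattice_pt P z) 1 0| < delta).

Hypothesis delta0 : 0 < delta.
Hypothesis good_often : forall n0, exists2 n, (n0 <= n)%N & good n.

Let cell (c : int * int) : set pt :=
  `[(delta * c.1%:~R), (delta * c.1%:~R + delta)[ `*`
  `[(delta * c.2%:~R), (delta * c.2%:~R + delta)[.

Let measurable_cell c : measurable (cell c).
Proof. by apply: measurableX; exact: measurable_itv. Qed.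

Let lebesgue_measure2_cell c : mu (cell c) = (delta ^+ 2)%:E.
Proof.
rewrite /lebesgue_measure2 product_measure1E//=; try exact: measurable_itv.
rewrite !lebesgue_measure_itv /= !lte_fin !ltrDl delta0 -!EFinB -EFinM; congr EFin.
ring.
Qed.

Let cell_cover (x : pt) : exists c, cell c x.
Proof.
have h (t : R) : `[(delta * (Num.floor (t / delta))%:~R),
    (delta * (Num.floor (t / delta))%:~R + delta)[%classic t.
  have /andP[] := floor_itv (t / delta).
  rewrite ler_pdivlMr// ltr_pdivrMr// intrD mulrDl mul1r !(mulrC _ delta) => h1 h2.
  by rewrite /= in_itv /= h1 h2.
exists (Num.floor (x.1 / delta), Num.floor (x.2 / delta)); split; exact: h.
Qed.

Let cell_diff c (x y : pt) : cell c x -> cell c y ->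
  `|(x.1 : R) - y.1| < delta /\ `|(x.2 : R) - y.2| < delta.
Proof.
rewrite /cell /= !in_itv /=.
move=> [/andP[x1 x1'] /andP[x2 x2']] [/andP[y1 y1'] /andP[y2 y2']].
by rewrite !ltr_norml; split; apply/andP; split; lra.
Qed.

(** The second number of the pair is only a counter: it makes each cell recur at arbitrarily late
    steps. *)
Let ncell (s : nat) : set pt :=
  oapp (fun ck : (int * int) * nat => cell ck.1) set0 (unpickle s).

Let ncell_often c N : exists2 s, (N <= s)%N & ncell s = cell c.
Proof.
have [k Nk] : exists k : nat, (N <= pickle (c, k))%N.
  apply: contrapT => /forallNP h.
  have hlt (k : nat) : (pickle (c, k) < N)%N by rewrite ltnNge; apply/negP/h.
  (* Pigeonhole: N + 1 counters cannot have distinct codes below N. *)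
  pose f (i : 'I_N.+1) : 'I_N := Ordinal (hlt (val i)).
  have /leq_card : injective f.
    move=> i j /(congr1 val) /= /(pcan_inj pickleK) [] ij; exact/val_inj.
  by rewrite !card_ord ltnn.
by exists (pickle (c, k)) => //; rewrite /ncell pickleK.
Qed.

Let piece s := D `&` ncell s.

Let measurable_piece s : measurable (piece s).
Proof. by apply: measurableI => //; rewrite /ncell; case: unpickle => /=. Qed.

Let lebesgue_measure2_piece s : (mu (piece s) <= (delta ^+ 2)%:E)%E.
Proof.
rewrite /piece /ncell; case: unpickle => [[c k]|] /=; last first.
  by rewrite setI0 measure0 lee_fin sqr_ge0.
rewrite -(lebesgue_measure2_cell c); apply: le_measure; rewrite ?inE//.
exact: measurableI.
Qed.

(** The growth makes the loss summable: the piece pulled back at step [t] has measure at most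
    2^-(t+1) |det A|^-(n s) for every s < t. *)
Let scales_exist : exists n : nat -> nat, (forall s, good (n s)) /\
  forall s t, (s < t)%N ->
    `|\det A| ^+ n s * delta ^+ 2 * (2 ^ t.+1)%:R <= `|\det A| ^+ n t.
Proof.
(* The pair is the last scale and its index; [ms.2.+2] is t + 1 for the next index t. *)
have step (ms : nat * nat) : exists m', [/\ (ms.1 <= m')%N, good m' &
    `|\det A| ^+ ms.1 * delta ^+ 2 * (2 ^ ms.2.+2)%:R <= `|\det A| ^+ m'].
  have [n0 hn0] := expr_unbounded
    (`|\det A| ^+ ms.1 * delta ^+ 2 * (2 ^ ms.2.+2)%:R) detA.
  have [n hn gn] := good_often (maxn ms.1 n0).
  by exists n; move: hn; rewrite geq_max => /andP[? ?]; split => //; exact: hn0.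
have [f hf] := choice step.
pose fix n s := if s is s'.+1 then f (n s', s') else f (0%N, 0%N).
have nS s : n s.+1 = f (n s, s) by [].
have mono s t : (s <= t)%N -> (n s <= n t)%N.
  move=> /subnK <-; elim: (t - s)%N => // k IH.
  by rewrite addSn nS (leq_trans IH)//; have [] := hf (n (k + s)%N, (k + s)%N).
exists n; split.
  by case=> [|s]; rewrite ?nS /=; [have [] := hf (0%N, 0%N)|have [] := hf (n s, s)].
move=> s [//|t] st; rewrite nS; have [_ _] := hf (n t, t); apply: le_trans => /=.
rewrite ler_wpM2r// ler_wpM2r ?sqr_ge0// ler_weXn2l ?(ltW detA)//.
exact: mono.
Qed.

Lemma multiscale_tile : exists U : set pt,
  [/\ measurable U, packs (eq_lattice P) U, packs (eq_dilation A) U &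
      mu.-negligible (~` saturation (eq_dilation A) U)].
Proof.
have [n [gn growth]] := scales_exist.
pose B s := lact (A ^+ n s) @^-1` piece s.
have mB s : measurable (B s) by exact: measurable_preim (measurable_lact _) _.
have packB s : packs (eq_lattice P) (B s).
  move=> x y Bx By [z yE]; have [z0|z0] := eqVneq z 0.
    by rewrite yE z0 lattice_pt0 translate0.
  (* Both images under [A ^+ n s] lie in one cell, yet they differ by the image of a nonzero lattice
     vector. *)
  exfalso; move: Bx By; rewrite yE /B /= lact_translate => -[_ +] [_ +].
  rewrite /ncell; case: unpickle => //= -[c k] /= Cx Cy.
  have [] := cell_diff Cy Cx; rewrite /= ![_ + (_ *m _) _ _]addrC !addrK => h1 h2.
  exact: (gn s z z0).
(* Later pieces have priority: B s only loses what the far smaller B t, t > s,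
   cover modulo the lattice. *)
pose E s := B s `&` \bigcup_k saturation (eq_lattice P) (B (s + k.+1)%N).
have mE s : measurable (E s).
  apply: measurableI => //; apply: bigcupT_measurable => k.
  exact: measurable_saturation_lattice.
pose B' s := B s `\` E s.
have mB' s : measurable (B' s) by exact: measurableD.
(* Along dilation orbits the priority is reversed: a point survives only if its orbit misses all
   earlier [B' r]. *)
pose U := \bigcup_s (B' s `\` \bigcup_(r in [set r | (r < s)%N])
  saturation (eq_dilation A) (B' r)).
exists U; split.
- apply: bigcupT_measurable => s; apply: measurableD => //.
  by apply: bigcup_measurable => r _; exact: measurable_saturation_dilation.
- move=> x y [s _ [[Bx nEx] _]] [t _ [[By nEy] _]] xy.
  have [st|ts|st] := ltngtP s t.
  + case: nEx; split => //; exists (t - s).-1 => //.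
    by exists y => //; rewrite prednK ?subn_gt0// subnKC// ltnW.
  + case: nEy; split => //; exists (s - t).-1 => //.
    exists x; last exact: eq_lattice_sym.
    by rewrite prednK ?subn_gt0// subnKC// ltnW.
  + by subst t; exact: (packB _ _ _ Bx By xy).
- move=> x y [s _ [B'x nx]] [t _ [B'y ny]] xy.
  have [st|ts|st] := ltngtP s t.
  + by case: ny; exists s => //; exists x => //; exact: eq_dilation_sym.
  + by case: nx; exists t => //; exists y.
  + subst t; case: B'x B'y => -[Dx _] _ [[Dy _] _].
    have : lact (A ^ (n s : int)) x = lact (A ^ (n s : int)) y.
      apply: packD => //; case: xy => m ->; exists m.
      by rewrite -!lact_expDz// addrC.
    by move=> /(congr1 (lact (A ^ (- (n s : int))))); rewrite !lact_expK.
(* The part of [D] lost at step [s]: [E s] carried back by [A ^ n s]. *)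
pose bad s := lact (A ^ (- (n s : int))) @^-1` E s.
have mbad s : measurable (bad s) by exact: measurable_preim (measurable_lact _) _.
have detA0 : 0 < `|\det A| by rewrite (lt_trans ltr01).
have mu_bad s : (mu (bad s) <= (1 / (2 ^ s.+1)%:R)%:E)%E.
  have -> : mu (bad s) = (mu (E s) * (`|\det A| ^+ n s)%:E)%E.
    have uAn : A ^ (- (n s : int)) \in unitmx by exact: unitmx_expz.
    rewrite -(lebesgue_measure2_lact uAn (mE s)) det_expz -muleA -EFinM.
    rewrite -(exprnN (\det A)) normfV normrX mulVf ?mule1//.
    by rewrite expf_neq0// gt_eqF.
  have muEk : (mu (E s) <= \sum_(k <oo) mu (B (s + k.+1)%N))%E.
    (* Modulo the lattice this part of [B s] lies in the later piece; since [B s] packs, its measure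
       is no larger. *)
    pose F k := B s `&` saturation (eq_lattice P) (B (s + k.+1)%N).
    have mF k : measurable (F k).
      by apply: measurableI => //; exact: measurable_saturation_lattice.
    apply: (@le_trans _ _ (\sum_(k <oo) mu (F k))%E).
      by apply: measure_sigma_subadditive => // x [Bx [k _ ?]]; exists k.
    apply: lee_nneseries => // k _.
    apply: (@packing_le_covering _ _ _ mu 'cV[int]_2
      (fun z => translate (- lattice_pt P z)) (fun z => translate (lattice_pt P z))) => //.
    + by move=> z; exact: measurable_translate.
    + by move=> z; exact: measurable_translate.
    + by move=> z S; exact: lebesgue_measure2_translate.
    + by move=> z x; rewrite translateD addNr translate0.
    + move=> y z yz; rewrite (_ : _ `&` _ = set0); first exact: negligible_set0.
      apply/seteqP; split => // x [[Bx _] [Bx' _]]; apply: yz.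
      have /(packB _ _ _ Bx Bx') : eq_lattice P
          (translate (- lattice_pt P y) x) (translate (- lattice_pt P z) x).
        by exists (y - z); rewrite translateD lattice_ptD lattice_ptN addKr.
      by move=> /(congr1 (@vec2 R)); rewrite !vec2_translate => /addrI/oppr_inj/(lattice_pt_inj uP).
    + rewrite (_ : _ `\` _ = set0); first exact: negligible_set0.
      by rewrite -saturation_latticeE; apply/seteqP; split => // x [[_ ?] ?].
  have muB t : (mu (B t) <= (delta ^+ 2 / `|\det A| ^+ n t)%:E)%E.
    have uAn : A ^+ n t \in unitmx by exact: (@unitmx_expz _ A (n t)).
    have dn0 : 0 < `|\det A| ^+ n t by rewrite exprn_gt0.
    rewrite EFinM lee_pdivlMr// -normrX -det_expr.
    by rewrite (lebesgue_measure2_lact uAn (measurable_piece t)).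
  have dn0 : 0 < `|\det A| ^+ n s by rewrite exprn_gt0.
  rewrite -lee_pdivlMr//; apply: (le_trans muEk).
  (* The measure allowed to [E s]; it is shared out among the later pieces as eps / 2^(k+1). *)
  pose eps := 1 / (2 ^ s.+1)%:R / `|\det A| ^+ n s.
  have eps0 : 0 <= eps by rewrite !divr_ge0// ltW.
  apply: le_trans (epsilon_trick0 xpredT eps0).
  apply: lee_nneseries => // k _; apply: (le_trans (muB _)); rewrite lee_fin.
  have st : (s < s + k.+1)%N by rewrite addnS ltnS leq_addr.
  have dt0 : 0 < `|\det A| ^+ n (s + k.+1)%N by rewrite exprn_gt0.
  have two0 m : 0 < (2 ^ m)%:R :> R by rewrite ltr0n expn_gt0.
  rewrite ler_pdivrMr// /eps -mulrA mul1r.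
  have := growth _ _ st; rewrite -addSn expnD natrM.
  move: (two0 s.+1) (two0 k.+1); set p := (2 ^ s.+1)%:R; set q := (2 ^ k.+1)%:R.
  move: dn0 dt0; set a := `|_| ^+ n s; set b := `|_| ^+ _ => a0 b0 p0 q0 h.
  have apq0 : 0 < a * (p * q) by rewrite !mulr_gt0.
  rewrite -(ler_pM2r apq0) (_ : _ * b * _ = b); last first.
    by field; rewrite !gt_eqF.
  by apply: le_trans h; rewrite le_eqVlt; apply/orP; left; apply/eqP; ring.
(* Borel-Cantelli: almost no point lies in infinitely many of the sets [bad s]. *)
have lim0 : mu (lim_sup_set bad) = 0%E.
  apply: lim_sup_set_cvg0 => //; apply: (@le_lt_trans _ _ 1%:E); last exact: ltry.
  apply: le_trans (epsilon_trick0 xpredT ler01).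
  by apply: lee_nneseries => // s _; exact: mu_bad.
have mlim : measurable (lim_sup_set bad).
  apply: bigcap_measurable => // k _; exact: bigcup_measurable.
apply: (@negligibleS _ _ _ _ (~` saturation (eq_dilation A) D `|`
    saturation (eq_dilation A) (lim_sup_set bad))); last first.
  apply: negligibleU => //; rewrite saturation_dilationE.
  apply: negligible_bigcup_count => m; apply: negligible_lact; first exact: unitmx_expz.
  by exists (lim_sup_set bad); split.
move=> x nUx; apply: contrapT => /not_orP[/contrapT [y Dy xy] nlim]; apply: nUx.
have nly : ~ lim_sup_set bad y by move=> ly; apply: nlim; exists y.
have [N nbad] : exists N, forall s, (N <= s)%N -> ~ bad s y.
  apply: contrapT => /forallNP h; apply: nly => N _.
  have /existsNP[s /not_implyP[Ns /contrapT]] := h N.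
  by exists s.
have [c cy] := cell_cover y.
(* From [N] on nothing is lost at [y], and its cell still recurs, so [y] survives at step [s]. *)
have [s Ns sc] := ncell_often c N.
have By : B s (lact (A ^ (- (n s : int))) y).
  by rewrite /B /= (@lact_expNK _ A (n s)) //; split => //; rewrite sc.
(* The first step whose surviving set meets the orbit of [x]: no earlier step can remove that point
   from [U]. *)
have [r [hr hmin]] : exists r, saturation (eq_dilation A) (B' r) x /\
    forall k, (k < r)%N -> ~ saturation (eq_dilation A) (B' k) x.
  have ex : exists r, `[< saturation (eq_dilation A) (B' r) x >].
    exists s; apply/asboolP; exists (lact (A ^ (- (n s : int))) y).
      by split => //; exact: nbad Ns.
    by apply: (eq_dilation_trans uA xy); exists (- (n s : int)).
  exists (ex_minn ex); case: ex_minnP => r /asboolP hr hmin; split => // k kr hk.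
  by move/asboolP: hk => /hmin; rewrite leqNgt kr.
case: hr => w B'w xw; exists w => //; exists r => //; split => // -[k kr [v Bv wv]].
by apply: (hmin k kr); exists v => //; exact: eq_dilation_trans wv.
Qed.
End MultiscaleTile.

(** * The annulus *)

Section Functionals.
Context {R : realType}.
Local Notation mu := (@lebesgue_measure2 R).
Local Notation pt := (measurableTypeR R * measurableTypeR R)%type.

Definition ev (u : 'rV[R]_2) (x : pt) : R := u 0 0 * x.1 + u 0 1 * x.2.

Lemma ev_lact u A x : ev u (lact A x) = ev (u *m A) x.
Proof. by rewrite /ev /lact !mulmx2E /=; ring. Qed.

Lemma ev_translate u a x : ev u (translate a x) = ev u x + (u *m a) 0 0.
Proof. by rewrite /ev /translate mulmx2E /=; ring. Qed.

Lemma eq_row2 (f g : 'rV[R]_2) : f 0 0 = g 0 0 -> f 0 1 = g 0 1 -> f = g.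
Proof. by move=> f0 f1; apply: trmx_inj; apply: eq_mx2 => j; rewrite ord1 !mxE. Qed.

Definition rows2 (f g : 'rV[R]_2) : 'M[R]_2 :=
  \matrix_(i, j) if i == 0 then f 0 j else g 0 j.

Lemma lact_rows2 f g x : lact (rows2 f g) x = (ev f x, ev g x).
Proof. by rewrite /lact !mxE. Qed.

Lemma det_rows2 f g : \det (rows2 f g) = f 0 0 * g 0 1 - f 0 1 * g 0 0.
Proof. by rewrite det_mx2 !mxE. Qed.

Lemma measurable_ev u : measurable_fun setT (ev u).
Proof. by apply: measurable_funD; apply: measurable_funM. Qed.

Lemma negligible_ev0 u : u != 0 -> mu.-negligible [set x | ev u x = 0].
Proof.
(* The second row is [u] turned by a right angle, so the determinant is the sum of the squares of
   the entries of [u]. *)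
move=> u0; pose M := rows2 u (\row_j if j == 0 then - u 0 1 else u 0 0).
have uM : M \in unitmx.
  rewrite unitmxE unitfE det_rows2 !mxE /=.
  rewrite (_ : _ - _ = u 0 0 ^+ 2 + u 0 1 ^+ 2); last by ring.
  apply: contraNneq u0 => /eqP; rewrite paddr_eq0 ?sqr_ge0// !sqrf_eq0.
  by move=> /andP[/eqP e0 /eqP e1]; apply/eqP/eq_row2; rewrite mxE.
rewrite (_ : mkset _ = lact M @^-1` ([set 0] `*` setT)).
  apply: negligible_lact => //; exists ([set 0] `*` setT); split => //.
    by apply: measurableX.
  transitivity (@lebesgue_measure R [set 0%R] * @lebesgue_measure R setT)%E.
    exact: product_measure1E.
  by rewrite lebesgue_measure_set1 mul0e.
by apply/seteqP; split => x; rewrite /preimage /mkset lact_rows2; [|case].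
Qed.
End Functionals.

Section Annulus.
Context {R : realType}.
Local Notation mu := (@lebesgue_measure2 R).
Local Notation pt := (measurableTypeR R * measurableTypeR R)%type.
Variables (A : 'M[R]_2) (u w : 'rV[R]_2) (a b : R).
Hypothesis uA : A \in unitmx.
(* u + i w is a complex left eigenvector of A for the eigenvalue a + i b. *)
Hypotheses (uE : u *m A = a *: u - b *: w) (wE : w *m A = b *: u + a *: w).
Hypothesis uw0 : (u != 0) || (w != 0).
Let rho := a ^+ 2 + b ^+ 2.
Hypothesis rho1 : 1 < rho.

(** The squared modulus of the complex functional u + i w, which treats complex eigenvalues over the
    reals; [A] multiplies it by [rho], the squared modulus of the eigenvalue. *)
Definition eigensquare (u w : 'rV[R]_2) (x : pt) : R := ev u x ^+ 2 + ev w x ^+ 2.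
Local Notation q := (eigensquare u w).

Let q_ge0 x : 0 <= q x.
Proof. by rewrite addr_ge0 ?sqr_ge0. Qed.

Let q_lact x : q (lact A x) = rho * q x.
Proof. by rewrite /eigensquare !ev_lact uE wE /ev !mxE /rho; ring. Qed.

Let rho0 : 0 < rho. Proof. exact: lt_trans rho1. Qed.

Lemma eigensquare_dilation (n : int) x : q (lact (A ^ n) x) = rho ^ n * q x.
Proof.
have hn (k : nat) y : q (lact (A ^+ k) y) = rho ^+ k * q y.
  elim: k y => [|k IH] y; first by rewrite !expr0 lact1 mul1r.
  by rewrite exprSr lact_mul IH q_lact exprSr mulrA.
case: (intP n) => [|k|k]; first by rewrite !expr0z lact1 mul1r.
  exact: hn.
have e := hn k.+1 (lact (A ^ (- k.+1%:Z)) x).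
rewrite (@lact_expNK _ A k.+1)// in e.
by rewrite e -exprnN mulKf// gt_eqF// exprn_gt0.
Qed.

Definition annulus (s : R) : set pt := [set x | s <= q x < rho * s].

Lemma measurable_annulus s : measurable (annulus s).
Proof.
have mq : measurable_fun setT q.
  by apply: measurable_funD; apply: measurable_funX; exact: measurable_ev.
rewrite (_ : annulus s = q @^-1` `[s, rho * s[%classic).
  by rewrite -[X in measurable X]setTI; apply: mq => //; exact: measurable_itv.
by apply/seteqP; split => x; rewrite /annulus /= in_itv.
Qed.

(** A positive power of [A] multiplies the square by at least [rho], the ratio of the outer bound to
    the inner one. *)
Lemma annulus_packs s : 0 < s -> packs (eq_dilation A) (annulus s).
Proof.
move=> s0; have h x y (n : nat) : annulus s x -> annulus s y ->
    y = lact (A ^ n.+1%:Z) x -> False.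
  move=> /andP[sx xs] /andP[sy ys] yE; move: ys; rewrite yE eigensquare_dilation.
  apply/negP; rewrite -leNgt; apply: ler_pM => //; try exact: ltW.
  by rewrite -exprnP exprS ler_peMr ?(ltW rho0)// exprn_ege1// ltW.
move=> x y Ax Ay [n yE]; case: (intP n) yE => [|k|k] yE.
- by rewrite yE expr0z lact1.
- by case: (h x y k).
- by case: (h y x k) => //; rewrite yE (@lact_expNK _ A k.+1).
Qed.

Lemma annulus_covers x : q x != 0 -> saturation (eq_dilation A) (annulus 1) x.
Proof.
move=> qx; have q0 : 0 < q x by rewrite lt_neqAle eq_sym qx q_ge0.
(* The offset [K] makes the least [n] positive, so that a search over naturals also reaches negative
   powers. *)
have [K hK] := expr_unbounded (q x + 1) rho1.
have rK : 0 < rho ^+ K by rewrite exprn_gt0.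
have [N hN] := expr_unbounded (rho ^+ K / q x) rho1.
have ex : exists n, rho ^+ K <= rho ^+ n * q x.
  by exists N; rewrite -ler_pdivrMr//; exact: hN.
case: (ex_minnP ex) => -[|n] hn hmin.
  move: hn; rewrite expr0 mul1r => /(le_trans (hK _ (leqnn K))).
  by rewrite gerDl ler10.
have {}hmin : rho ^+ n * q x < rho ^+ K.
  by rewrite ltNge; apply/negP => /hmin; rewrite ltnn.
exists (lact (A ^ (n.+1%:Z - K%:Z)) x); last by exists (n.+1%:Z - K%:Z).
rewrite /annulus /= mulr1 eigensquare_dilation expfzDr ?gt_eqF// -exprnN -exprnP.
rewrite mulrAC ler_pdivlMr// mul1r hn ltr_pdivrMr//.
by rewrite exprS -mulrA ltr_pM2l.
Qed.

Lemma negligible_eigensquare0 : mu.-negligible [set x | q x = 0].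
Proof.
have h x : q x = 0 -> ev u x = 0 /\ ev w x = 0.
  move/eqP; rewrite /eigensquare paddr_eq0 ?sqr_ge0// !sqrf_eq0.
  by move=> /andP[/eqP ? /eqP ?].
by case/orP: uw0 => /negligible_ev0; apply: negligibleS => x /h[].
Qed.

Lemma negligible_annulus : mu.-negligible (~` saturation (eq_dilation A) (annulus 1)).
Proof.
apply: negligibleS negligible_eigensquare0 => x nx /=.
by apply/eqP/negPn/negP => /annulus_covers.
Qed.

Lemma dilation_fixpoint (n : int) x : n != 0 -> x = lact (A ^ n) x -> q x = 0.
Proof.
move=> n0 /(congr1 q); rewrite eigensquare_dilation => /eqP.
rewrite -subr_eq0 -{1}[q x]mul1r -mulrBl mulf_eq0 => /orP[|/eqP//].
rewrite subr_eq0 eq_sym pexprz_eq1 ?ltW// (negbTE n0) /= => /eqP r1.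
by move: rho1; rewrite r1 ltxx.
Qed.
End Annulus.

(** * Fundamental domains *)

Section Bridge.
Context {R : realType}.
Local Notation mu := (@lebesgue_measure2 R).
Local Notation pt := (measurableTypeR R * measurableTypeR R)%type.
Implicit Types (A P M N : 'M[R]_2) (S : set 'cV[R]_2).

Lemma vec2_preimage_translate S a :
  vec2 @^-1` [set x + a | x in S] = translate (- a) @^-1` (vec2 @^-1` S).
Proof.
apply/seteqP; split => p /=.
  by move=> [x Sx xp]; rewrite vec2_translate -xp addrK.
by rewrite vec2_translate => Sp; exists (vec2 p - a) => //; rewrite subrK.
Qed.

Lemma vec2_preimage_mulmx S M N : M *m N = 1%:M -> N *m M = 1%:M ->
  vec2 @^-1` [set M *m x | x in S] = lact N @^-1` (vec2 @^-1` S).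
Proof.
move=> MN NM; apply/seteqP; split => p /=.
  by move=> [x Sx xp]; rewrite vec2_lact -xp mulmxA NM mul1mx.
by rewrite vec2_lact => Sp; exists (N *m vec2 p) => //; rewrite mulmxA MN mul1mx.
Qed.

Lemma vec2_preimage_dilation S A (n : int) : A \in unitmx ->
  vec2 @^-1` [set A ^ n *m x | x in S] = lact (A ^ (- n)) @^-1` (vec2 @^-1` S).
Proof.
move=> uA; apply: vec2_preimage_mulmx.
  by rewrite -[LHS]/(A ^ n * A ^ (- n)) -exprzDr// addrN expr0z.
by rewrite -[LHS]/(A ^ (- n) * A ^ n) -exprzDr// addNr expr0z.
Qed.

Lemma measurable2_borel S : measurable (vec2 @^-1` S) -> measurable2 S.
Proof.
by move=> mS; exists (vec2 @^-1` S) => //; exists set0; [exact: negligible_set0|rewrite setU0].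
Qed.

Lemma vec2_image_preimage (X : set pt) : vec2 @^-1` (vec2 @` X) = X.
Proof.
apply/seteqP; split => x /=; last by exists x.
by move=> [y Xy /vec2_inj <-].
Qed.
End Bridge.

(** * The half-open fundamental parallelogram of the lattice *)

Section FundamentalDomain.
Context {R : realType}.
Local Notation mu := (@lebesgue_measure2 R).
Local Notation pt := (measurableTypeR R * measurableTypeR R)%type.
Variable P : 'M[R]_2.
Hypothesis uP : P \in unitmx.

Let unit_square : set pt := `[0, 1[%classic `*` `[0, 1[%classic.

Definition fundamental_domain : set pt := lact (invmx P) @^-1` unit_square.

Lemma measurable_fundamental_domain : measurable fundamental_domain.
Proof.
apply: measurable_preim (measurable_lact _) _.
by apply: measurableX; exact: measurable_itv.
Qed.

Lemma fundamental_domain_finite : (mu fundamental_domain < +oo)%E.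
Proof.
have mQ : measurable unit_square by apply: measurableX; exact: measurable_itv.
have uiP : invmx P \in unitmx by rewrite unitmx_inv.
have d0 : 0 < `|\det (invmx P)|.
  by rewrite normr_gt0; move: uiP; rewrite unitmxE unitfE.
have e : mu unit_square = 1%E.
  transitivity (@lebesgue_measure R `[0%R, 1%R[ * @lebesgue_measure R `[0%R, 1%R[)%E.
    exact: product_measure1E.
  by rewrite !lebesgue_measure_itv /= lte_fin ltr01 oppr0 adde0 mule1.
have := lebesgue_measure2_lact uiP mQ; rewrite e -/fundamental_domain => h.
by rewrite ltey; apply/eqP => oo; move: h; rewrite oo gt0_mulye.
Qed.

Lemma lact_invmx_lattice z x :
  lact (invmx P) (translate (lattice_pt P z) x) =
  translate (map_mx intr z) (lact (invmx P) x).
Proof. by rewrite lact_translate mulKmx. Qed.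

Lemma fundamental_domain_packs : packs (eq_lattice P) fundamental_domain.
Proof.
have h (t : R) (k : int) : 0 <= t < 1 -> 0 <= t + k%:~R < 1 -> k = 0.
  move=> /andP[t0 t1] /andP[k0 k1].
  have : (-1)%:~R < k%:~R :> R by rewrite mulrNz; lra.
  have : k%:~R < 1%:~R :> R by rewrite mulr1z; lra.
  by rewrite !ltr_int; lia.
move=> x y; rewrite /fundamental_domain => -[/=]; rewrite !in_itv /= => x1 x2.
move=> + [z yE]; rewrite /= yE lact_invmx_lattice => -[/=].
rewrite !in_itv /= !mxE => y1 y2.
suff -> : z = 0 by rewrite lattice_pt0 translate0.
by apply: eq_mx2 => j; rewrite ord1 [RHS]mxE; [exact: h x1 y1|exact: h x2 y2].
Qed.

Lemma fundamental_domain_covers x : saturation (eq_lattice P) fundamental_domain x.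
Proof.
pose y := lact (invmx P) x.
pose z : 'cV[int]_2 := \col_i (if i == 0 then - Num.floor y.1 else - Num.floor y.2).
exists (translate (lattice_pt P z) x); last by exists z.
rewrite /fundamental_domain /= lact_invmx_lattice -/y.
have h (t : R) : 0 <= t + (- Num.floor t)%:~R < 1.
  by have := floor_itv t; rewrite intrD mulrNz => /andP[? ?]; apply/andP; split; lra.
by split; rewrite /= in_itv /= !mxE /=; exact: h.
Qed.

(* The square root of eigensquare is a seminorm, so far out the annulus is wider
   than the domain. *)
Lemma fundamental_domain_in_annulus (u w : 'rV[R]_2) (rho : R) :
  1 < rho -> (u != 0) || (w != 0) ->
  exists (z : 'cV[int]_2) (s : R), 0 < s /\
   forall x, fundamental_domain x ->
     s <= eigensquare u w (translate (lattice_pt P z) x) < rho * s.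
Proof.
move=> rho1 uw.
have [z q0] : exists z, 0 < (u *m lattice_pt P z) 0 0 ^+ 2 + (w *m lattice_pt P z) 0 0 ^+ 2.
  have h (f : 'rV[R]_2) : f != 0 -> exists z, (f *m lattice_pt P z) 0 0 != 0.
    move=> f0; have fP0 : f *m P != 0.
      by apply: contra_neq f0 => e; rewrite -[f](mulmxK uP) e mul0mx.
    have [i fi] : exists i, (f *m P) 0 i != 0.
      apply: contrapT => /forallNP n; case/eqP: fP0; apply/matrixP => i j.
      by rewrite ord1 [RHS]mxE; apply/eqP/negPn/negP/n.
    exists (delta_mx i 0); apply: contra_neq fi => e; rewrite -[RHS]e.
    rewrite /lattice_pt mulmxA [in RHS]mxE (bigD1 i)//= big1 => [|j ji].
      by rewrite !mxE !eqxx mulr1 addr0.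
    by rewrite !mxE (negbTE ji) mulr0.
  case/orP: uw => /h [z fz]; exists z.
    by rewrite ltr_pwDl ?sqr_ge0// exprn_even_gt0.
  by rewrite ltr_wpDl ?sqr_ge0// exprn_even_gt0.
set a := (u *m _) _ _ in q0; set b := (w *m _) _ _ in q0.
have [C C0 hC] : exists2 C : R, 0 <= C & forall x, fundamental_domain x ->
    `|ev u x| <= C /\ `|ev w x| <= C.
  exists (`|(u *m P) 0 0| + `|(u *m P) 0 1| + (`|(w *m P) 0 0| + `|(w *m P) 0 1|)).
    by rewrite !addr_ge0.
  move=> x Fx; have [y + ->] : exists2 y, unit_square y & x = lact P y.
    by exists (lact (invmx P) x) => //; rewrite -lact_mul mulmxV// lact1.
  move=> []; rewrite /= !in_itv /= => /andP[y1 y1'] /andP[y2 y2'].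
  rewrite !ev_lact /ev.
  have h (c1 c2 : R) : `|c1 * y.1 + c2 * y.2| <= `|c1| + `|c2|.
    apply: le_trans (ler_normD _ _) _; rewrite !normrM (ger0_norm y1) (ger0_norm y2).
    by apply: lerD; rewrite ler_piMr// ltW.
  split; apply: le_trans (h _ _) _; first by rewrite lerDl addr_ge0.
  by rewrite lerDr addr_ge0.
(* On the domain moved by [m] times the lattice vector, the square differs from m^2 q by at most m
   K. With [m] so large that m^2 q + m K < rho (m^2 q - m K), the value s = m^2 q - m K works. *)
pose q := a ^+ 2 + b ^+ 2; pose K := 2 * C * (`|a| + `|b|) + 2 * C ^+ 2.
have K0 : 0 <= K by rewrite addr_ge0 ?mulr_ge0 ?addr_ge0 ?sqr_ge0.
pose m := (Num.bound `|K * (rho + 1) / (q * (rho - 1))|).+1.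
have mK : K * (rho + 1) < m%:R * (q * (rho - 1)).
  rewrite -ltr_pdivrMr ?mulr_gt0 ?subr_gt0//.
  apply: le_lt_trans (ler_norm _) (lt_trans (archi_boundP (normr_ge0 _)) _).
  by rewrite ltr_nat.
have m1 : 1 <= m%:R :> R by rewrite ler1n.
have q0' : 0 < q by [].
exists (z *+ m), (m%:R * (m%:R * q - K)).
have mq : K < m%:R * q.
  have rho0 : 0 < rho - 1 by rewrite subr_gt0.
  rewrite -(ltr_pM2r rho0) -mulrA; apply: le_lt_trans mK.
  by rewrite ler_wpM2l//; lra.
split; first by rewrite mulr_gt0 ?subr_gt0// (lt_le_trans ltr01).
move=> x /hC[]; rewrite /eigensquare !ev_translate.
have e f : (f *m lattice_pt P (z *+ m)) 0 0 = m%:R * (f *m lattice_pt P z) 0 0.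
  rewrite /lattice_pt raddfMn /= mulmxA (mulmxA f P).
  by rewrite -scaler_nat -scalemxAr mxE.
rewrite !e -/a -/b; move: (ev u x) (ev w x) => e1 e2.
rewrite !ler_norml => /andP[h1 h1'] /andP[h2 h2'].
set M := m%:R in mK m1 mq *.
have cross (c t : R) : - C <= t -> t <= C -> - (C * `|c|) <= c * t <= C * `|c|.
  move=> t1 t2; rewrite -ler_norml normrM mulrC ler_wpM2r// ler_norml t1//.
have /andP[p1 p1'] := cross a e1 h1 h1'.
have /andP[p2 p2'] := cross b e2 h2 h2'.
have sq (t : R) : - C <= t -> t <= C -> t ^+ 2 <= C ^+ 2.
  by move=> t1 t2; rewrite -[leLHS]real_normK ?num_real// lerXn2r ?nnegrE// ler_norml t1.
have s1 := sq _ h1 h1'; have s2 := sq _ h2 h2'.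
have -> : (e1 + M * a) ^+ 2 + (e2 + M * b) ^+ 2 =
    M ^+ 2 * q + (e1 ^+ 2 + e2 ^+ 2) + 2 * (M * (a * e1 + b * e2)) by rewrite /q; ring.
have X1 : - (C * (`|a| + `|b|)) <= a * e1 + b * e2 by rewrite mulrDr opprD lerD.
have X2 : a * e1 + b * e2 <= C * (`|a| + `|b|) by rewrite mulrDr lerD.
have M0 : 0 <= M := le_trans ler01 m1.
have Y1 := ler_wpM2l M0 X1; have Y2 := ler_wpM2l M0 X2.
have sC : 0 <= C ^+ 2 by rewrite sqr_ge0.
have Z : C ^+ 2 <= M * C ^+ 2 by rewrite ler_peMl.
have t1 := sqr_ge0 e1; have t2 := sqr_ge0 e2.
have MK : M * K = 2 * (M * (C * (`|a| + `|b|))) + 2 * (M * C ^+ 2) by rewrite /K; ring.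
have W : M * (K * (rho + 1)) < M * (M * (q * (rho - 1))) by rewrite ltr_pM2l// (lt_le_trans ltr01).
have W' : M * (K * (rho + 1)) = rho * (M * K) + M * K by ring.
have W'' : M * (M * (q * (rho - 1))) = rho * (M ^+ 2 * q) - M ^+ 2 * q by ring.
have V1 : M * (M * q - K) = M ^+ 2 * q - M * K by ring.
have V2 : rho * (M * (M * q - K)) = rho * (M ^+ 2 * q) - rho * (M * K) by ring.
move: W; rewrite V2 V1 W' W'' => W.
clear -Y1 Y2 MK W t1 t2 s1 s2 Z.
apply/andP; split; lra.
Qed.
End FundamentalDomain.

(** * Existence of common tiles *)

Section Existence.
Context {R : realType}.
Local Notation mu := (@lebesgue_measure2 R).
Local Notation pt := (measurableTypeR R * measurableTypeR R)%type.

Lemma measurable_exchange (A P : 'M[R]_2) (U V : set pt) : measurable U -> measurable V ->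
  measurable (exchange (eq_lattice P) (eq_dilation A) U V).
Proof.
move=> mU mV.
have mc i : measurable (chain (eq_lattice P) (eq_dilation A) U V i).
  elim: i => [|i IH] /=.
    by apply: measurableD => //; exact: measurable_saturation_lattice.
  apply: measurableI => //; apply: measurable_saturation_lattice.
  by apply: measurableI => //; exact: measurable_saturation_dilation.
have mc' : measurable (\bigcup_i chain (eq_lattice P) (eq_dilation A) U V i).
  exact: bigcupT_measurable.
apply: measurableU => //; apply: measurableD => //.
exact: measurable_saturation_dilation.
Qed.

(** The lattice acts freely, so orbit packing makes the translates disjoint. Two dilates can meet
    only at fixed points of a nontrivial power of [A], which the last hypothesis makes null. *)
Lemma tiles_both_of_packs (A P : 'M[R]_2) (T : set pt) :
  A \in unitmx -> P \in unitmx -> measurable T ->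
  packs (eq_lattice P) T -> (forall x, saturation (eq_lattice P) T x) ->
  packs (eq_dilation A) T -> mu.-negligible (~` saturation (eq_dilation A) T) ->
  (forall n, n != 0 -> mu.-negligible [set x | x = lact (A ^ n) x]) ->
  tiles_both (vec2 @` T) A P.
Proof.
move=> uA uP mT packP coverP packA coverA fixA.
have neg0 : mu.-negligible set0 := negligible_set0 _.
split.
- by apply: measurable2_borel; rewrite vec2_image_preimage.
- split.
  + move=> a _; apply: measurable2_borel; rewrite vec2_preimage_translate.
    rewrite vec2_image_preimage; exact: measurable_preim (measurable_translate _) mT.
  + move=> _ _ [y _ <-] [z _ <-] yz; rewrite /negligible2 preimage_setI.
    rewrite !vec2_preimage_translate !vec2_image_preimage.
    apply: negligibleS neg0 => x [Ty Tz]; apply: yz.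
    have : eq_lattice P (translate (- lattice_pt P y) x) (translate (- lattice_pt P z) x).
      by exists (y - z); rewrite translateD lattice_ptD lattice_ptN addKr.
    move=> /(packP _ _ Ty Tz) /(congr1 (@vec2 R)).
    by rewrite !vec2_translate => /addrI/oppr_inj.
  + apply: negligibleS neg0 => x; apply; have [t Tt [z tE]] := coverP x.
    exists (- lattice_pt P z).
      by exists (- z) => //; rewrite -[LHS]/(lattice_pt P _) lattice_ptN.
    exists (vec2 t); first by exists t.
    by rewrite tE vec2_translate addrK.
- split.
  + move=> n _; apply: measurable2_borel; rewrite vec2_preimage_dilation//.
    rewrite vec2_image_preimage; exact: measurable_preim (measurable_lact _) mT.
  + move=> m n _ _ mn; rewrite /negligible2 preimage_setI.
    rewrite !vec2_preimage_dilation// !vec2_image_preimage.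
    have mn0 : m - n != 0 by rewrite subr_eq0; exact/eqP.
    apply: negligibleS (fixA _ mn0) => x [Tm Tn] /=.
    have : eq_dilation A (lact (A ^ (- m)) x) (lact (A ^ (- n)) x).
      by exists (m - n); rewrite -lact_expDz// addrAC subrr add0r.
    move=> /(packA _ _ Tm Tn) /(congr1 (lact (A ^ m))).
    by rewrite lact_expNK// -lact_expDz.
  + apply: negligibleS coverA => x /= nx [t Tt [n tE]]; apply: nx.
    exists (- n) => //; exists (vec2 t); first by exists t.
    by rewrite -vec2_lact tE lact_expK.
Qed.

Theorem tiles_both_exist (A P : 'M[R]_2) (u w : 'rV[R]_2) (a b delta : R) :
  A \in unitmx -> P \in unitmx -> 1 < `|\det A| ->
  u *m A = a *: u - b *: w -> w *m A = b *: u + a *: w ->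
  (u != 0) || (w != 0) -> 1 < a ^+ 2 + b ^+ 2 -> 0 < delta ->
  (forall n0, exists2 n, (n0 <= n)%N & forall z : 'cV[int]_2, z != 0 ->
    ~ (`|(A ^+ n *m lattice_pt P z) 0 0| < delta /\
       `|(A ^+ n *m lattice_pt P z) 1 0| < delta)) ->
  exists T : set 'cV[R]_2, tiles_both T A P.
Proof.
move=> uA uP detA uE wE uw rho1 delta0 good.
set rho := a ^+ 2 + b ^+ 2 in rho1.
have [U [mU packPU packAU coverU]] := multiscale_tile uP uA detA
  (measurable_annulus u w a b 1) (annulus_packs uA uE wE rho1 ltr01)
  (negligible_annulus uA uE wE uw rho1) delta0 good.
have [z [s [s0 hV]]] := fundamental_domain_in_annulus uP rho1 uw.
(* The fundamental domain, moved by a lattice vector so as to lie in one annulus, is still an exact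
   lattice tile. *)
pose V := translate (- lattice_pt P z) @^-1` fundamental_domain P.
have mV : measurable V.
  exact: measurable_preim (measurable_translate _) (measurable_fundamental_domain P).
have trI c : injective (@translate R c).
  by move=> x y /(congr1 (@vec2 R)); rewrite !vec2_translate => /addIr/vec2_inj.
have packPV : packs (eq_lattice P) V.
  move=> x y Vx Vy [t yE]; apply: (trI (- lattice_pt P z)).
  apply: (fundamental_domain_packs uP Vx Vy); exists t.
  by rewrite yE !translateD addrC.
have coverPV x : saturation (eq_lattice P) V x.
  have [y Fy xy] := fundamental_domain_covers uP x.
  exists (translate (lattice_pt P z) y).
    by rewrite /V /= translateD addrN translate0.
  by apply: eq_lattice_trans xy _; exists z.
have packAV : packs (eq_dilation A) V.
  move=> x y Vx Vy; apply: (annulus_packs uA uE wE rho1 s0).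
    by have := hV _ Vx; rewrite translateD addNr translate0.
  by have := hV _ Vy; rewrite translateD addNr translate0.
pose T := exchange (eq_lattice P) (eq_dilation A) U V.
have symP := @eq_lattice_sym R P; have transP := @eq_lattice_trans R P.
have symA x y := @eq_dilation_sym R A x y uA.
have transA x y t := @eq_dilation_trans R A x y t uA.
exists (vec2 @` T); apply: tiles_both_of_packs => //.
- exact: measurable_exchange.
- exact: exchange_packs_l.
- exact: exchange_saturation_l.
- exact: exchange_packs_r.
- by apply: negligibleS coverU; apply: subsetC; exact: exchange_saturation_r.
- move=> n n0; apply: negligibleS (negligible_eigensquare0 uw) => x.
  exact: (dilation_fixpoint uA uE wE rho1).
Qed.
End Existence.

(** * Nonexistence *)

Section Nonexistence.
Context {R : realType}.
Local Notation mu := (@lebesgue_measure2 R).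
Local Notation pt := (measurableTypeR R * measurableTypeR R)%type.

Lemma fundamental_domain_neq0 (P : 'M[R]_2) : P \in unitmx ->
  mu (fundamental_domain P) != 0%E.
Proof.
move=> uP; have mQ : measurable (`[0%R, 1%R[%classic `*` `[0%R, 1%R[%classic : set pt).
  by apply: measurableX; exact: measurable_itv.
have uiP : invmx P \in unitmx by rewrite unitmx_inv.
apply/eqP => e; have := lebesgue_measure2_lact uiP mQ.
rewrite -/(fundamental_domain P) e mul0e => /esym.
rewrite [LHS](_ : _ = @lebesgue_measure R `[0%R, 1%R[ * @lebesgue_measure R `[0%R, 1%R[)%E.
  by rewrite !lebesgue_measure_itv /= lte_fin ltr01 oppr0 adde0 mule1 => /eqP; rewrite onee_eq0.
exact: product_measure1E.
Qed.

(** A Lebesgue measurable tile is a Borel set together with a null set; both groups are countable,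
    so the orbits of the null set stay null and the Borel part still covers. *)
Lemma borel_tile (S : set 'cV[R]_2) (A P : 'M[R]_2) : A \in unitmx -> P \in unitmx ->
  tiles_both S A P -> exists T : set pt, [/\ measurable T,
    forall y z, y <> z -> mu.-negligible (translate (- lattice_pt P y) @^-1` T `&`
                                          translate (- lattice_pt P z) @^-1` T),
    mu.-negligible (~` \bigcup_z translate (lattice_pt P z) @^-1` T),
    forall m n : int, m <> n ->
      mu.-negligible (lact (A ^ (- m)) @^-1` T `&` lact (A ^ (- n)) @^-1` T) &
    mu.-negligible (~` \bigcup_n lact (A ^ n) @^-1` T)].
Proof.
move=> uA uP [[T mT [N nN TN]] [_ packP coverP] [_ packA coverA]].
have TNS x : (T x \/ N x) = S (vec2 x) := congr1 (@^~ x) TN.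
have TS x : T x -> S (vec2 x) by move=> Tx; rewrite -TNS; left.
have ST x : S (vec2 x) -> T x \/ N x by rewrite TNS.
exists T; split => //.
- move=> y z yz.
  have := packP (lattice_pt P y) (lattice_pt P z).
  have Py : lattice P (lattice_pt P y) by exists y.
  have Pz : lattice P (lattice_pt P z) by exists z.
  have yz' : lattice_pt P y <> lattice_pt P z by move/(lattice_pt_inj uP).
  move=> /(_ Py Pz yz'); rewrite /negligible2 preimage_setI !vec2_preimage_translate.
  by apply: negligibleS => x [/TS ? /TS].
- apply: (@negligibleS _ _ _ _ (vec2 @^-1` (~` \bigcup_(a in lattice P) [set x + a | x in S])
    `|` \bigcup_z translate (lattice_pt P z) @^-1` N)); last first.
    apply: negligibleU => //; apply: negligible_bigcup_count => z.
    exact: negligible_translate.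
  move=> x nx; apply: contrapT => /not_orP[/= /contrapT [a [z _ <-] Sx] nNx]; apply: nx.
  have : (vec2 @^-1` [set x + P *m map_mx intr z | x in S]) x by [].
  rewrite vec2_preimage_translate -[P *m _]/(lattice_pt P z) -lattice_ptN.
  by move=> /ST[Tx|Nx]; [exists (- z)|case: nNx; exists (- z)].
- move=> m n mn; have := packA m n I I mn.
  rewrite /negligible2 preimage_setI !vec2_preimage_dilation//.
  by apply: negligibleS => x [/TS ? /TS].
- apply: (@negligibleS _ _ _ _ (vec2 @^-1` (~` \bigcup_(n in [set: int]) [set A ^ n *m x | x in S])
    `|` \bigcup_n lact (A ^ n) @^-1` N)); last first.
    apply: negligibleU => //; apply: negligible_bigcup_count => z.
    by apply: negligible_lact => //; exact: unitmx_expz.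
  move=> x nx; apply: contrapT => /not_orP[/= /contrapT [n _ Sx] nNx]; apply: nx.
  have : (vec2 @^-1` [set A ^ n *m x | x in S]) x by [].
  rewrite vec2_preimage_dilation//.
  by move=> /ST[Tx|Nx]; [exists (- n)|case: nNx; exists (- n)].
Qed.

(** * Measure of a Borel common tile *)

Section BorelTile.
Variables (A P : 'M[R]_2) (T : set pt).
Hypotheses (uA : A \in unitmx) (uP : P \in unitmx) (mT : measurable T).
Hypothesis packP : forall y z, y <> z ->
  mu.-negligible (translate (- lattice_pt P y) @^-1` T `&`
                  translate (- lattice_pt P z) @^-1` T).
Hypothesis coverP : mu.-negligible (~` \bigcup_z translate (lattice_pt P z) @^-1` T).
Hypothesis packA : forall m n : int, m <> n ->
  mu.-negligible (lact (A ^ (- m)) @^-1` T `&` lact (A ^ (- n)) @^-1` T).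
Hypothesis coverA : mu.-negligible (~` \bigcup_n lact (A ^ n) @^-1` T).

Let translateNK a : cancel (@translate R (- a)) (translate a).
Proof. by move=> x; rewrite translateD addNr translate0. Qed.

(** [T] packs and the fundamental domain covers, so [T] has no larger measure. *)
Lemma tile_finite : (mu T < +oo)%E.
Proof.
apply: le_lt_trans (fundamental_domain_finite uP).
apply: (@packing_le_covering _ _ _ mu 'cV[int]_2
  (fun z => translate (- lattice_pt P z)) (fun z => translate (lattice_pt P z))) => //.
- by move=> z; exact: measurable_translate.
- by move=> z; exact: measurable_translate.
- by move=> z S; exact: lebesgue_measure2_translate.
- exact: measurable_fundamental_domain.
- rewrite (_ : _ `\` _ = set0); first exact: negligible_set0.
  rewrite -saturation_latticeE; apply/seteqP; split => // x [_]; apply.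
  exact: fundamental_domain_covers.
Qed.

(** The same comparison with the roles exchanged. *)
Lemma tile_neq0 : mu T != 0%E.
Proof.
apply: contra (fundamental_domain_neq0 uP) => /eqP T0.
rewrite -measure_le0 -T0.
apply: (@packing_le_covering _ _ _ mu 'cV[int]_2
  (fun z => translate (- lattice_pt P z)) (fun z => translate (lattice_pt P z))) => //.
- by move=> z; exact: measurable_translate.
- by move=> z; exact: measurable_translate.
- by move=> z S; exact: lebesgue_measure2_translate.
- exact: measurable_fundamental_domain.
- move=> y z yz; rewrite (_ : _ `&` _ = set0); first exact: negligible_set0.
  apply/seteqP; split => // x [Fy Fz]; apply: yz.
  have : eq_lattice P (translate (- lattice_pt P y) x) (translate (- lattice_pt P z) x).
    by exists (y - z); rewrite translateD lattice_ptD lattice_ptN addKr.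
  move=> /(fundamental_domain_packs uP Fy Fz) /(congr1 (@vec2 R)).
  by rewrite !vec2_translate => /addrI/oppr_inj/(lattice_pt_inj uP).
- by apply: negligibleS coverP => x [].
Qed.

(* T and 2T are fundamental domains of the same measure preserving action. *)
Lemma unimodular_no_tile : `|\det A| = 1 -> False.
Proof.
(* [H] halves vectors, so the preimage of [T] is 2T, of measure 4 mu(T); being scalar, [H] commutes
   with the powers of [A]. *)
move=> detA1; pose H : 'M[R]_2 := 2^-1%:M.
have detH : \det H = 4^-1.
  by rewrite /H det_scalar exprVn -natrX.
have uH : H \in unitmx by rewrite unitmxE detH unitfE invr_eq0.
have commH (n : int) x : lact H (lact (A ^ n) x) = lact (A ^ n) (lact H x).
  by rewrite -!lact_mul scalar_mxC.
have : (mu (lact H @^-1` T) <= mu T)%E.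
  apply: (@packing_le_covering _ _ _ mu int
    (fun n => lact (A ^ (- n))) (fun n => lact (A ^ n))) => //.
  - by move=> z; exact: measurable_lact.
  - by move=> z; exact: measurable_lact.
  - move=> n S mS; have uAn : A ^ (- n) \in unitmx by exact: unitmx_expz.
    rewrite -[RHS](lebesgue_measure2_lact uAn mS) det_expz.
    suff -> : `|\det A ^ (- n)| = 1 by rewrite mule1.
    by case: (- n) => k; rewrite /exprz ?normfV normrX detA1 expr1n ?invr1.
  - by move=> n x; rewrite lact_expNK.
  - exact: measurable_preim (measurable_lact _) mT.
  - move=> m n /packA /(negligible_lact uH); apply: negligibleS => x /=.
    by rewrite -!commH.
  - by apply: negligibleS coverA => x [].
have := lebesgue_measure2_lact uH mT; rewrite detH ger0_norm ?invr_ge0// => e.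
have mH : mu (lact H @^-1` T) != +oo%E.
  have q0 : (0 < (4^-1 : R)%:E)%E by rewrite lte_fin invr_gt0.
  by apply/eqP => oo; have := tile_finite; rewrite -e oo (gt0_mulye q0) ltxx.
rewrite -[leRHS]e; have := tile_neq0; rewrite -e.
have X0 : (0 <= mu (lact H @^-1` T))%E by [].
move: X0 mH; case: (mu (lact H @^-1` T)) => [r| |]// r0 _.
rewrite -EFinM eqe !lee_fin in r0 * => rn rr.
by move: rn; rewrite (_ : r = 0) ?mul0r ?eqxx//; lra.
Qed.
End BorelTile.
End Nonexistence.

Lemma ltz_addS (m n : int) : m < n -> exists k : nat, n = m + k.+1%:Z.
Proof. by move=> mn; exists `|n - m|%N.-1; lia. Qed.

(** * A lattice vector in the contracted direction *)

Section ContractedLatticeVector.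
Context {R : realType}.
Local Notation mu := (@lebesgue_measure2 R).
Local Notation leb := (@lebesgue_measure R).
Local Notation pt := (measurableTypeR R * measurableTypeR R)%type.
Variables (A P : 'M[R]_2) (T : set pt) (l1 l2 : R) (f1 f2 : 'rV[R]_2)
  (z : 'cV[int]_2).
Hypotheses (uA : A \in unitmx) (mT : measurable T) (T_fin : (mu T < +oo)%E).
Hypothesis packP : forall y z, y <> z ->
  mu.-negligible (translate (- lattice_pt P y) @^-1` T `&`
                  translate (- lattice_pt P z) @^-1` T).
Hypothesis coverA : mu.-negligible (~` \bigcup_n lact (A ^ n) @^-1` T).
Hypothesis f1E : f1 *m A = l1 *: f1.
Hypotheses (f1z : (f1 *m lattice_pt P z) 0 0 = 0)
  (f2z : (f2 *m lattice_pt P z) 0 0 = 1).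
Hypothesis uM : rows2 f1 f2 \in unitmx.
Hypotheses (l1_gt1 : 1 < `|l1|) (l2_lt1 : `|l2| < 1)
  (detA : `|\det A| = `|l1 * l2|) (detA1 : 1 <= `|\det A|).

Let M := rows2 f1 f2.

Let lact_M x : lact M x = (ev f1 x, ev f2 x).
Proof.
by rewrite /M lact_rows2.
Qed.

Let detM0 : 0 < `|\det M|.
Proof. by rewrite normr_gt0; move: uM; rewrite unitmxE unitfE. Qed.

Let l10 : 0 < `|l1|. Proof. exact: lt_trans l1_gt1. Qed.

Let shell : set R := [set t | 1 <= `|t| < `|l1|].

Let measurable_shell : measurable (shell : set (measurableTypeR R)).
Proof.
rewrite (_ : shell = `]- `|l1|, -1] `|` `[1, `|l1|[).
  by apply: measurableU; exact: measurable_itv.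
apply/seteqP; split => t; rewrite /shell /= !in_itv /=.
  case: (ger0P t) => t0 /andP[h1 h2]; first by right; rewrite h1.
  by left; apply/andP; split; lra.
by move=> [/andP[h1 h2]|/andP[h1 h2]]; [rewrite ltr0_norm|rewrite gtr0_norm];
  try lra; apply/andP; split; lra.
Qed.

Let shell_finite : (leb shell < +oo)%E.
Proof.
apply: (@le_lt_trans _ _ (leb `[(- `|l1|)%R, `|l1|%R])); last first.
  by rewrite lebesgue_measure_itv /=; case: ifP => _; rewrite ?ltry// -EFinB ltry.
apply: le_measure; rewrite ?inE//.
by move=> t; rewrite /shell /= in_itv /= => /andP[_ /ltW]; rewrite ler_norml.
Qed.

Let shell_neq0 : leb shell != 0%E.
Proof.
apply/eqP => e; have : (leb `[1%R, `|l1|%R[ <= leb shell)%E.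
  apply: le_measure; rewrite ?inE//.
  move=> t; rewrite /shell /= in_itv /= => /andP[h1 h2].
  by rewrite ger0_norm ?h1//; lra.
by rewrite e lebesgue_measure_itv /= lte_fin l1_gt1 -EFinB lee_fin subr_le0 leNgt l1_gt1.
Qed.

(** The preimage of [strip 0] under [A ^ n]: a pair of bands parallel to the kernel of [f1]. *)
Let strip (n : int) : set pt := [set x | shell (l1 ^ n * ev f1 x)].

Let measurable_strip n : measurable (strip n).
Proof.
have mf : measurable_fun setT (fun x : pt => l1 ^ n * ev f1 x).
  by apply: measurable_funM => //; exact: measurable_ev.
by rewrite -[X in measurable X]setTI; exact: (mf _ _ measurable_shell).
Qed.

Let ev_expz (n : int) x : ev f1 (lact (A ^ n) x) = l1 ^ n * ev f1 x.
Proof.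
have h (k : nat) y : ev f1 (lact (A ^+ k) y) = l1 ^+ k * ev f1 y.
  elim: k y => [|k IH] y; first by rewrite !expr0 lact1 mul1r.
  rewrite exprSr lact_mul IH exprSr -mulrA; congr (_ * _).
  by rewrite ev_lact f1E /ev !mxE; ring.
case: (intP n) => [|k|k]; first by rewrite !expr0z lact1 mul1r.
  exact: h.
have e := h k.+1 (lact (A ^ (- k.+1%:Z)) x).
rewrite (@lact_expNK _ A k.+1)// in e.
by rewrite e -exprnN mulKf// expf_neq0// -normr_eq0 gt_eqF.
Qed.

Let strip_lact m n : lact (A ^ m) @^-1` strip n = strip (n + m).
Proof.
apply/seteqP; split => x; rewrite /strip /= ev_expz mulrA -expfzDr//;
by rewrite -normr_eq0 gt_eqF.
Qed.

Let strip_disjoint m n : m != n -> strip m `&` strip n = set0.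
Proof.
wlog mn : m n / m < n.
  move=> h mn; case: (ltgtP m n) mn => [mn|nm|->]; rewrite ?eqxx//.
    by move=> ?; apply: h => //; rewrite lt_eqF.
  by move=> ?; rewrite setIC; apply: h => //; rewrite lt_eqF.
move=> _; apply/seteqP; split => // x [].
rewrite /strip /shell /= !normrM.
have normz (k : int) : `|l1 ^ k| = `|l1| ^ k.
  by case: k => k; rewrite /exprz ?normfV normrX.
rewrite !normz => /andP[h1 h2] /andP[h3 h4].
have [k kE] := ltz_addS mn.
move: h4; rewrite kE expfzDr ?gt_eqF// mulrAC -exprnP exprS mulrCA.
apply/negP; rewrite -leNgt ler_peMr ?normr_ge0//.
by apply: mulr_ege1 => //; rewrite exprn_ege1// ltW.
Qed.

Let mu_strip : mu (strip 0) = +oo%E.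
Proof.
have mX : measurable (shell `*` setT : set pt) by exact: measurableX.
have e : mu (shell `*` setT) = +oo%E.
  transitivity (leb shell * leb setT)%E; first exact: product_measure1E.
  have -> : leb setT = +oo%E by rewrite -set_itvNyy lebesgue_measure_itv.
  by rewrite gt0_muley// lt_neqAle eq_sym shell_neq0 measure_ge0.
have := lebesgue_measure2_lact uM mX.
have -> : lact M @^-1` (shell `*` setT) = strip 0.
  by apply/seteqP; split => x; rewrite /strip /preimage /mkset lact_M expr0z mul1r; [case|].
rewrite -/M e => h; apply/eqP; rewrite -leye_eq leNgt; apply/negP => fin.
by move: h; rewrite -[mu _]fineK ?ge0_fin_numE// -EFinM.
Qed.

(* Translates of T by multiples of P z, along the contracted direction, are
   almost disjoint, so T meets a strip in at most one period of it. *)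
Let packing_in_strip (k : nat) :
  (mu (T `&` strip k) <= leb shell * (`|\det M| * `|l1| ^+ k)^-1%:E)%E.
Proof.
pose J : set (measurableTypeR R) := (fun t : R => l1 ^+ k * t) @^-1` shell.
have mJ : measurable J.
  have mf : measurable_fun setT ((fun t : R => l1 ^+ k * t) : measurableTypeR R -> measurableTypeR R).
    exact: measurable_funM.
  by rewrite -[X in measurable X]setTI; exact: mf.
(* One period of the strip: translation by the vector of [z] adds 1 to [f2] and fixes [f1]. *)
pose D := lact M @^-1` (J `*` `[0%R, 1%R[%classic).
have mX : measurable (J `*` `[0%R, 1%R[%classic : set pt).
  by apply: measurableX => //; exact: measurable_itv.
have mD : measurable D by exact: measurable_preim (measurable_lact _) _.
have l1k0 : 0 < `|l1| ^+ k by rewrite exprn_gt0.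
apply: (@le_trans _ _ (mu D)); last first.
  rewrite -lee_pdivrMr ?invr_gt0 ?mulr_gt0// invrK EFinM muleA.
  rewrite (lebesgue_measure2_lact uM mX).
  rewrite [mu _](_ : _ = leb J * leb `[0%R, 1%R[)%E; last exact: product_measure1E.
  rewrite [leb `[_, _[]lebesgue_measure_itv /= lte_fin ltr01 oppr0 adde0 mule1 -normrX.
  rewrite lebesgue_measure_scale// expf_neq0// -normr_eq0 gt_eqF//.
pose v := lattice_pt P z.
have vM (j : int) : lattice_pt P (z *~ j) = j%:~R *: v.
  by rewrite /lattice_pt /v raddfMz /= -scaler_int -scalemxAr.
have fv (f : 'rV[R]_2) (j : int) :
    (f *m lattice_pt P (z *~ j)) 0 0 = j%:~R * (f *m lattice_pt P z) 0 0.
  by rewrite vM -scalemxAr mxE.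
apply: (@packing_le_covering _ _ _ mu int
  (fun j => translate (- lattice_pt P (z *~ j))) (fun j => translate (lattice_pt P (z *~ j)))) => //.
- by move=> j; exact: measurable_translate.
- by move=> j; exact: measurable_translate.
- by move=> j S; exact: lebesgue_measure2_translate.
- by move=> j x; rewrite translateD addNr translate0.
- exact: measurableI.
- move=> i j ij; have zij : z *~ i <> z *~ j.
    move=> /(congr1 (fun t => (f2 *m lattice_pt P t) 0 0)).
    by rewrite !fv f2z !mulr1 => /intr_inj.
  by apply: negligibleS (packP zij) => x [[Ti _] [Tj _]].
- rewrite (_ : _ `\` _ = set0); first exact: negligible_set0.
  apply/seteqP; split => // x [[_ sx]]; apply.
  exists (- Num.floor (ev f2 x)) => //; rewrite /D /preimage /mkset lact_M !ev_translate.
  rewrite !fv f1z f2z mulr0 addr0 mulr1; split => //=.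
  have := floor_itv (ev f2 x); rewrite in_itv /= intrD mulrNz => /andP[? ?].
  by apply/andP; split; lra.
Qed.

(** The part [X k] of [strip 0] in A^k T has measure O(|l1|^(-k) |det A|^k) = O(|l2|^k). The parts
    [Y k] in A^(-k) T come from disjoint pieces of [T] by maps that do not expand area, so their
    measures sum to at most mu(T). Yet [strip 0] has infinite measure. *)
Lemma contracted_lattice_vector_no_tile : False.
Proof.
pose X (k : nat) := strip 0 `&` lact (A ^ (- k%:Z)) @^-1` T.
pose Y (k : nat) := strip 0 `&` lact (A ^ k%:Z) @^-1` T.
have mX k : measurable (X k).
  by apply: measurableI => //; exact: measurable_preim (measurable_lact _) mT.
have mY k : measurable (Y k).
  by apply: measurableI => //; exact: measurable_preim (measurable_lact _) mT.
have mXU : measurable (\bigcup_k X k) by exact: bigcupT_measurable.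
have mYU : measurable (\bigcup_k Y k) by exact: bigcupT_measurable.
have dA0 : 0 < `|\det A| := lt_le_trans ltr01 detA1.
pose c := fine (leb shell) / `|\det M|.
have c0 : 0 <= c by rewrite divr_ge0// fine_ge0.
have muX k : (mu (X k) <= (geometric c `|l2| k)%:E)%E.
  have uAk : A ^+ k \in unitmx by exact: (@unitmx_expz _ A k).
  have := lebesgue_measure2_lact uAk (mX k).
  have -> : lact (A ^+ k) @^-1` X k = T `&` strip k.
    rewrite /X preimage_setI (strip_lact k) add0r setIC; congr (_ `&` _).
    by apply/seteqP; split => x /=; rewrite (@lact_expK _ A k).
  rewrite det_expr normrX => <-.
  have dk0 : 0 <= `|\det A| ^+ k by rewrite exprn_ge0.
  apply: le_trans (lee_wpmul2r _ (packing_in_strip k)) _; first by rewrite lee_fin.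
  rewrite -[leb shell]fineK ?ge0_fin_numE// -!EFinM lee_fin detA normrM exprMn /geometric /=.
  rewrite /c le_eqVlt; apply/orP; left; apply/eqP.
  by field; rewrite (gt_eqF detM0) expf_neq0// gt_eqF.
have muY k : (mu (Y k) <= mu (T `&` strip (- k%:Z)))%E.
  have uAk : A ^ (- k%:Z) \in unitmx by exact: unitmx_expz.
  have := lebesgue_measure2_lact uAk (mY k).
  have -> : lact (A ^ (- k%:Z)) @^-1` Y k = T `&` strip (- k%:Z).
    rewrite /Y preimage_setI strip_lact add0r setIC; congr (_ `&` _).
    by apply/seteqP; split => x /=; rewrite (@lact_expNK _ A k).
  move=> <-; rewrite det_expz -(exprnN (\det A)) normfV normrX.
  rewrite -[leRHS]mule1; apply: lee_wpmul2l; first exact: measure_ge0.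
  by rewrite lee_fin invf_le1 ?exprn_gt0// exprn_ege1.
have XU : (mu (\bigcup_k X k) < +oo)%E.
  apply: le_lt_trans (_ : _ <= \sum_(k <oo) mu (X k))%E _.
    exact: measure_sigma_subadditive.
  apply: le_lt_trans (_ : _ <= \sum_(k <oo) (geometric c `|l2| k)%:E)%E _.
    by apply: lee_nneseries => // k _; exact: muX.
  apply: (@le_lt_trans _ _ (c * (1 - `|l2|)^-1 + c)%:E); last exact: ltry.
  apply: lime_le.
    by apply: is_cvg_nneseries => k _ _; rewrite lee_fin geometric_ge0.
  apply: nearW => n; rewrite sumEFin lee_fin.
  have q0 : 0 <= c * (1 - `|l2|)^-1 by rewrite mulr_ge0// invr_ge0 subr_ge0 ltW.
  (* [geometric_le_lim] asks for a positive ratio; for ratio 0 the sum is at most its first term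
     [c], whence the extra [c] in the bound. *)
  have [l20|l20] := eqVneq l2 0.
    case: n => [|n]; first by rewrite big_geq// addr_ge0.
    rewrite big_nat_recl//= expr0 mulr1 big1_seq ?addr0 => [|k _].
      by rewrite lerDr.
    by rewrite l20 normr0 exprS mul0r mulr0.
  rewrite -[leLHS]addr0 lerD//.
  by apply: geometric_le_lim; rewrite ?normr_gt0// normr_id.
have YU : (mu (\bigcup_k Y k) < +oo)%E.
  apply: le_lt_trans (_ : _ <= \sum_(k <oo) mu (Y k))%E _.
    exact: measure_sigma_subadditive.
  apply: le_lt_trans (_ : _ <= \sum_(k <oo) mu (T `&` strip (- k%:Z)))%E _.
    by apply: lee_nneseries => // k _; exact: muY.
  have mTs k : measurable (T `&` strip (- k%:Z)) by exact: measurableI.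
  have mU : measurable (\bigcup_k (T `&` strip (- k%:Z))) by exact: bigcupT_measurable.
  have tr : trivIset setT (fun k : nat => T `&` strip (- k%:Z)).
    apply/trivIsetP => i j _ _ ij; rewrite setIACA strip_disjoint ?setI0//.
    by rewrite eqr_opp.
  rewrite -(measure_semi_bigcup mu mTs tr mU).
  apply: le_lt_trans T_fin; apply: le_measure; rewrite ?inE//.
  by move=> x [k _ []].
have h : (mu (strip 0) <= mu (\bigcup_k X k `|` \bigcup_k Y k))%E.
  apply: le_measure_negligible => //; first exact: measurableU.
  apply: negligibleS coverA => x [sx nXY] [n _ Tx]; apply: nXY.
  case: (intP n) Tx => [|k|k] Tx; first by left; exists 0%N.
    by right; exists k.+1.
  by left; exists k.+1.
have := le_lt_trans (le_trans h (measureU2 mu mXU mYU)) (lte_add_pinfty XU YU).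
by rewrite mu_strip.
Qed.
End ContractedLatticeVector.

(** * Scales without short lattice vectors *)

Section OneNorm.
Variable K : numDomainType.

(** Over any [numDomainType], so that it serves real vectors and their complexifications alike. *)
Definition onenorm (v : 'cV[K]_2) : K := `|v 0 0| + `|v 1 0|.

Lemma onenorm_ge0 v : 0 <= onenorm v.
Proof. by rewrite addr_ge0. Qed.

Lemma onenormD v w : onenorm (v + w) <= onenorm v + onenorm w.
Proof. by rewrite /onenorm !mxE addrACA lerD// ler_normD. Qed.

Lemma onenormN v : onenorm (- v) = onenorm v.
Proof. by rewrite /onenorm !mxE !normrN. Qed.

Lemma onenormZ a v : onenorm (a *: v) = `|a| * onenorm v.
Proof. by rewrite /onenorm !mxE !normrM mulrDr. Qed.

Lemma onenorm_mulmx (M : 'M[K]_2) v :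
  onenorm (M *m v) <= (`|M 0 0| + `|M 1 0| + (`|M 0 1| + `|M 1 1|)) * onenorm v.
Proof.
rewrite /onenorm !mulmx2E.
set a := M 0 0; set b := M 1 0; set c := M 0 1; set d := M 1 1.
apply: (@le_trans _ _ ((`|a| + `|b|) * `|v 0 0| + (`|c| + `|d|) * `|v 1 0|)).
  rewrite !mulrDl addrACA -!normrM.
  by rewrite lerD// ler_normD.
rewrite [leRHS]mulrDr; apply: lerD; apply: ler_wpM2r => //.
  by rewrite lerDl addr_ge0.
by rewrite lerDr addr_ge0.
Qed.
End OneNorm.

Lemma normz_ge1 (k : int) : k != 0 -> 1 <= `|k|.
Proof. by lia. Qed.

Lemma intvec_neq0 (z : 'cV[int]_2) : z != 0 -> (z 0 0 != 0) || (z 1 0 != 0).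
Proof.
apply: contraNT; rewrite negb_or !negbK => /andP[/eqP h0 /eqP h1].
by apply/eqP/eq_mx2 => j; rewrite ord1 mxE.
Qed.

Lemma intvec_norm_ge1 (z : 'cV[int]_2) : z != 0 -> 1 <= `|z 0 0| + `|z 1 0|.
Proof. by move=> /intvec_neq0; move: (z 0 0) (z 1 0); lia. Qed.

Section GoodScales.
Context {R : realType}.
Implicit Types (A P : 'M[R]_2).

(** A nonzero integer vector has norm at least 1, and [invmx P] is bounded. *)
Lemma onenorm_lattice P : P \in unitmx ->
  exists2 S : R, 0 < S & forall z : 'cV[int]_2, z != 0 -> 1 <= S * onenorm (lattice_pt P z).
Proof.
move=> uP; pose Q := invmx P.
exists (1 + (`|Q 0 0| + `|Q 1 0| + (`|Q 0 1| + `|Q 1 1|))).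
  by rewrite ltr_pwDl// !addr_ge0.
move=> z z0; have : 1 <= onenorm (map_mx intr z : 'cV[R]_2).
  rewrite /onenorm !mxE -!intr_norm -intrD -[1]/(1%:~R) ler_int.
  exact: intvec_norm_ge1.
move=> /le_trans; apply.
have {1}-> : map_mx intr z = Q *m lattice_pt P z by rewrite /lattice_pt mulKmx.
apply: le_trans (onenorm_mulmx _ _) _; rewrite ler_wpM2r ?onenorm_ge0//.
by rewrite lerDr.
Qed.

Lemma eigenvalues2_poly A (l1 l2 : R[i]) : eigenvalues2 A l1 l2 ->
  (complexify A - l1%:M) * (complexify A - l2%:M) = 0.
Proof.
move=> heig; have := Cayley_Hamilton (complexify A).
by rewrite heig rmorphM !rmorphB /= horner_mx_X !horner_mx_C.
Qed.

(** The norm p(v) = |v| + K |(A - l2) v| does not decrease under [A]: by Cayley-Hamilton (A - l2) v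
    is scaled by l1, and K (|l1| - 1) = 1 absorbs the error in |v| <= |A v| + |(A - l2) v|. This
    covers Jordan blocks as well. *)
Lemma eigenvalues2_expanding A (l1 l2 : R[i]) : eigenvalues2 A l1 l2 ->
  1 < `|l1| -> 1 <= `|l2| ->
  exists2 C : R, 0 < C & forall n (v : 'cV[R]_2), onenorm v <= C * onenorm (A ^+ n *m v).
Proof.
move=> heig l1_gt1 l2_ge1; set Ac := complexify A.
pose B := Ac - l2%:M; pose K := (`|l1| - 1)^-1.
have K0 : 0 < K by rewrite invr_gt0 subr_gt0.
pose p v := onenorm v + K * onenorm (B *m v).
have AB v : Ac *m (B *m v) = l1 *: (B *m v).
  have := eigenvalues2_poly heig; rewrite -/Ac -/B => /(congr1 (mulmx^~ v)).
  rewrite mul0mx -mulmxA mulmxBl mul_scalar_mx => /eqP.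
  by rewrite subr_eq0 => /eqP.
have BA v : B *m (Ac *m v) = Ac *m (B *m v).
  rewrite !mulmxA; congr (_ *m v).
  by rewrite /B mulmxBl mulmxBr scalar_mxC.
have p_mono v : p v <= p (Ac *m v).
  rewrite /p BA AB onenormZ.
  have h : onenorm v <= onenorm (Ac *m v) + onenorm (B *m v).
    apply: (@le_trans _ _ (onenorm (l2 *: v))).
      by rewrite onenormZ ler_peMl// onenorm_ge0.
    have -> : l2 *: v = Ac *m v + - (B *m v).
      by rewrite /B mulmxBl mul_scalar_mx opprB addrC subrK.
    by apply: le_trans (onenormD _ _) _; rewrite onenormN.
  apply: le_trans (lerD h (lexx _)) _; rewrite -addrA lerD2l.
  rewrite -[X in X + _]mul1r -mulrDl mulrA ler_wpM2r ?onenorm_ge0//.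
  rewrite -subr_ge0 (_ : _ - _ = 0) //.
  have : K * (`|l1| - 1) = 1 by rewrite mulVf// gt_eqF// subr_gt0.
  by move=> <-; rewrite mulrBr mulr1; ring.
have p_iter n v : p v <= p (Ac ^+ n *m v).
  elim: n v => [|n IH] v; first by rewrite expr0 mul1mx.
  by apply: le_trans (IH v) _; rewrite exprS -mulmxA.
pose S := `|B 0 0| + `|B 1 0| + (`|B 0 1| + `|B 1 1|).
have S0 : 0 <= S by rewrite !addr_ge0.
pose C := 1 + K * S.
have C0 : 0 < C by rewrite ltr_pwDl// mulr_ge0// ltW.
have main n v : onenorm v <= C * onenorm (Ac ^+ n *m v).
  apply: le_trans (_ : p v <= _); first by rewrite lerDl mulr_ge0 ?onenorm_ge0// ltW.
  apply: le_trans (p_iter n v) _; rewrite /p /C mulrDl mul1r lerD2l -mulrA.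
  by rewrite ler_wpM2l ?(ltW K0)// onenorm_mulmx.
have real_norm (x : R) : `|real_complex R x| = real_complex R `|x|.
  by rewrite normc_def /= expr0n /= addr0 sqrtr_sqr.
have real_onenorm (v : 'cV[R]_2) : onenorm (complexify v) = real_complex R (onenorm v).
  by rewrite /onenorm !mxE !real_norm -rmorphD.
(* The constant so far lives in R[i], where norms take their values; being positive, it is real. *)
have [c cE] : exists c : R, C = real_complex R c.
  by apply/complex_realP; rewrite realE ltW.
exists c; first by rewrite -ltcR -cE.
move=> n v; have := main n (complexify v).
have -> : Ac ^+ n *m complexify v = complexify (A ^+ n *m v).
  by rewrite /complexify map_mxM /= rmorphXn.
by rewrite !real_onenorm cE -rmorphM lecR.
Qed.

Lemma expanding_good A P (l1 l2 : R[i]) : P \in unitmx -> eigenvalues2 A l1 l2 ->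
  1 < `|l1| -> 1 <= `|l2| ->
  exists2 delta : R, 0 < delta & forall n (z : 'cV[int]_2), z != 0 ->
    ~ (`|(A ^+ n *m lattice_pt P z) 0 0| < delta /\
       `|(A ^+ n *m lattice_pt P z) 1 0| < delta).
Proof.
move=> uP heig h1 h2.
have [C C0 hC] := eigenvalues2_expanding heig h1 h2.
have [S S0 hS] := onenorm_lattice uP.
(* The factor 2 passes from a bound on each coordinate to one on their sum. *)
exists (S * C * 2)^-1; first by rewrite invr_gt0 !mulr_gt0.
move=> n z z0 []; set v := A ^+ n *m _ => v0 v1.
have : onenorm v < (S * C)^-1.
  apply: lt_le_trans (ltrD v0 v1) _.
  by rewrite (_ : _ + _ = (S * C)^-1)//; field; rewrite !gt_eqF.
apply/negP; rewrite -leNgt -[leLHS]mul1r ler_pdivrMr ?mulr_gt0//.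
apply: le_trans (hS z z0) _; rewrite mulrC [S * C]mulrC mulrA ler_wpM2r ?(ltW S0)//.
by rewrite mulrC hC.
Qed.

Lemma eigenrow_expr (A : 'M[R]_2) (f : 'rV[R]_2) (l : R) (n : nat) (v : 'cV[R]_2) :
  f *m A = l *: f -> (f *m (A ^+ n *m v)) 0 0 = l ^+ n * (f *m v) 0 0.
Proof.
move=> fE; suff fn : f *m A ^+ n = l ^+ n *: f by rewrite mulmxA fn -scalemxAl mxE.
elim: n => [|n IH]; first by rewrite !expr0 mulmx1 scale1r.
by rewrite exprSr -[_ * A]/(_ *m A) mulmxA IH -scalemxAl fE scalerA -exprSr.
Qed.

(* If every scale n >= N had a short lattice vector, then two consecutive ones
   would span a parallelogram of area below the covolume, hence be parallel; all
   of them would be multiples of one vector, on which f1 is bounded below. *)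
Lemma saddle_good A P (l1 l2 : R) (f1 f2 : 'rV[R]_2) : P \in unitmx ->
  f1 *m A = l1 *: f1 -> f2 *m A = l2 *: f2 -> rows2 f1 f2 \in unitmx ->
  1 < `|l1| -> `|l2| <= 1 -> 1 < `|l1 * l2| ->
  (forall z : 'cV[int]_2, z != 0 -> (f1 *m lattice_pt P z) 0 0 != 0) ->
  forall n0, exists2 n, (n0 <= n)%N & forall z : 'cV[int]_2, z != 0 ->
    ~ (`|(A ^+ n *m lattice_pt P z) 0 0| < 1 /\
       `|(A ^+ n *m lattice_pt P z) 1 0| < 1).
Proof.
move=> uP f1E f2E uM l1_gt1 l2_le1 l12_gt1 irr n0.
have l20 : l2 != 0 by apply: contraTneq l12_gt1 => ->; rewrite mulr0 normr0 ltr10.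
set g1 := fun z : 'cV[int]_2 => (f1 *m lattice_pt P z) 0 0.
set g2 := fun z : 'cV[int]_2 => (f2 *m lattice_pt P z) 0 0.
(* [C] bounds both functionals on vectors with coordinates below 1 in modulus. *)
pose C := 1 + (`|f1 0 0| + `|f1 0 1| + (`|f2 0 0| + `|f2 0 1|)).
have C1 : 1 <= C by rewrite lerDl !addr_ge0.
have C0 : 0 < C := lt_le_trans ltr01 C1.
have l10 : 0 < `|l1| := lt_trans ltr01 l1_gt1.
have l20' : 0 < `|l2| by rewrite normr_gt0.
pose kappa := `|\det (rows2 f1 f2 *m P)|.
have kappa0 : 0 < kappa.
  by rewrite normr_gt0 -unitfE -unitmxE unitmx_mul uM.
(* In the coordinates [f1], [f2], the area spanned by two lattice vectors is the covolume times an
   integer. *)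
have area (y z : 'cV[int]_2) : g1 y * g2 z - g1 z * g2 y =
    \det (rows2 f1 f2 *m P) * (y 0 0 * z 1 0 - y 1 0 * z 0 0)%:~R.
  rewrite det_mx2 !mulmx2E !mxE /= /g1 /g2 /lattice_pt !mulmx2E !mxE.
  by rewrite rmorphB !rmorphM /=; ring.
(* From [N1] on, kappa |l1|^n |l2|^(n+1) exceeds 2 C^2, which leaves no room for a nonzero
   integer. *)
have [N1 hN1] := expr_unbounded (C * C * 2 / (kappa * `|l2|) + 1) l12_gt1.
pose N := maxn n0 N1.
apply: contrapT => /forall2NP nogood.
have short n : (N <= n)%N -> exists z : 'cV[int]_2, [/\ z != 0,
    `|l1| ^+ n * `|g1 z| <= C & `|l2| ^+ n * `|g2 z| <= C].
  rewrite geq_max => /andP[hn _]; have [//|] := nogood n.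
  move=> /existsNP[z /not_implyP[z0 /contrapT[a0 a1]]]; exists z.
  have bound (f : 'rV[R]_2) (v : 'cV[R]_2) : `|v 0 0| < 1 -> `|v 1 0| < 1 ->
      `|(f *m v) 0 0| <= `|f 0 0| + `|f 0 1|.
    move=> v0 v1; rewrite mulmx2E; apply: le_trans (ler_normD _ _) _; rewrite !normrM.
    by apply: lerD; rewrite ler_piMr// ltW.
  split => //; rewrite -normrX -normrM.
    rewrite /g1 -(eigenrow_expr _ _ f1E); apply: le_trans (bound _ _ a0 a1) _.
    by rewrite /C addrCA lerDl addr_ge0// addr_ge0.
  rewrite /g2 -(eigenrow_expr _ _ f2E); apply: le_trans (bound _ _ a0 a1) _.
  by rewrite /C addrA lerDr addr_ge0// addr_ge0.
pose cross (y z : 'cV[int]_2) := y 0 0 * z 1 0 - y 1 0 * z 0 0.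
have parallel n (y z : 'cV[int]_2) : (N <= n)%N ->
    `|l1| ^+ n * `|g1 y| <= C -> `|l2| ^+ n * `|g2 y| <= C ->
    `|l1| ^+ n.+1 * `|g1 z| <= C -> `|l2| ^+ n.+1 * `|g2 z| <= C -> cross y z = 0.
  rewrite geq_max => /andP[_ hn] y1 y2 z1 z2; apply/eqP; apply: contraT => cr.
  have {}cr : 1 <= `|(cross y z)%:~R| :> R.
    by rewrite -intr_norm -[1]/(1%:~R) ler_int normz_ge1.
  have lo : kappa <= `|g1 y| * `|g2 z| + `|g1 z| * `|g2 y|.
    rewrite -!normrM; apply: le_trans (ler_normB _ _); rewrite area normrM.
    by rewrite -/kappa ler_peMr ?(ltW kappa0).
  have l1n0 : 0 < `|l1| ^+ n by rewrite exprn_gt0.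
  have l2n0 : 0 < `|l2| ^+ n by rewrite exprn_gt0.
  (* The weights |l1|^n and |l2|^(n+1) are valid for both vectors, since |l1| > 1 and |l2| <= 1. *)
  have z1' : `|l1| ^+ n * `|g1 z| <= C.
    apply: le_trans z1; rewrite ler_wpM2r// exprS ler_peMl ?(ltW l1n0)//.
    exact: ltW.
  have y2' : `|l2| ^+ n.+1 * `|g2 y| <= C.
    apply: le_trans y2; rewrite ler_wpM2r// exprS ler_piMl ?(ltW l2n0)//.
  have up : (`|l1| ^+ n * `|l2| ^+ n.+1) * (`|g1 y| * `|g2 z| + `|g1 z| * `|g2 y|)
      <= C * C * 2.
    rewrite mulrDr mulr_natr mulr2n; apply: lerD; rewrite mulrACA;
    by apply: ler_pM => //; rewrite mulr_ge0// exprn_ge0.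
  have := hN1 n hn; rewrite normrM exprMn leNgt => /negP[].
  rewrite ltr_pwDr// ler_pdivlMr ?mulr_gt0//; apply: le_trans up.
  rewrite [leLHS](_ : _ = `|l1| ^+ n * `|l2| ^+ n.+1 * kappa); last first.
    by rewrite exprS; ring.
  by rewrite ler_wpM2l// mulr_ge0// exprn_ge0.
have [zeta hz] := choice (fun n => short (N + n)%N (leq_addr n N)).
(* Parallelism passes on from [zeta n] to [zeta n.+1] because [zeta n] is nonzero. *)
have cross_all n : cross (zeta 0%N) (zeta n) = 0.
  elim: n => [|n IH]; first by rewrite /cross mulrC subrr.
  have [zn0 a1 a2] := hz n; have [_ b1 b2] := hz n.+1; rewrite addnS in b1 b2.
  have := parallel _ _ _ (leq_addr n N) a1 a2 b1 b2; move: IH; rewrite /cross.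
  have := intvec_neq0 zn0.
  move: (zeta 0%N 0 0) (zeta 0%N 1 0) (zeta n 0 0) (zeta n 1 0) (zeta n.+1 0 0) (zeta n.+1 1 0).
  move=> y0 y1 x0 x1 z0 z1 xn0 /eqP; rewrite subr_eq0 => /eqP e1 /eqP.
  rewrite subr_eq0 => /eqP e2; apply/eqP; rewrite subr_eq0.
  case/orP: xn0 => xi; rewrite -(inj_eq (mulfI xi)); apply/eqP.
    by rewrite mulrCA e2 mulrA e1; ring.
  by rewrite mulrA [x1 * y0]mulrC e1 -mulrA e2; ring.
have g1E t : g1 t = (f1 *m P) 0 0 * (t 0 0)%:~R + (f1 *m P) 0 1 * (t 1 0)%:~R.
  by rewrite /g1 /lattice_pt mulmxA mulmx2E ![map_mx _ _ _ _]mxE.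
have [y0 g1y _] := hz 0%N; set y := zeta 0%N in y0 g1y cross_all.
have gy0 : 0 < `|g1 y| by rewrite normr_gt0 irr.
pose Y := `|(y 0 0)%:~R| + `|(y 1 0)%:~R| : R.
(* As [zeta n] is parallel to [y], g1(zeta n) y = g1(y) zeta n, and a nonzero integer vector has
   norm at least 1; the bound does not depend on [n]. *)
have lower n : `|g1 y| <= `|g1 (zeta n)| * Y.
  have [zn0 _ _] := hz n; have gz0 : g1 (zeta n) != 0 by exact: irr.
  have /eqP := cross_all n; rewrite /cross subr_eq0 => /eqP /(congr1 (fun k : int => k%:~R : R)).
  rewrite !intrM => cE.
  have E0 : g1 (zeta n) * (y 0 0)%:~R = g1 y * (zeta n 0 0)%:~R.
    rewrite !g1E; transitivity ((f1 *m P) 0 0 * (zeta n 0 0)%:~R * (y 0 0)%:~R +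
      (f1 *m P) 0 1 * ((y 0 0)%:~R * (zeta n 1 0)%:~R)); first by ring.
    by rewrite cE; ring.
  have E1 : g1 (zeta n) * (y 1 0)%:~R = g1 y * (zeta n 1 0)%:~R.
    rewrite !g1E; transitivity ((f1 *m P) 0 0 * ((y 1 0)%:~R * (zeta n 0 0)%:~R) +
      (f1 *m P) 0 1 * (zeta n 1 0)%:~R * (y 1 0)%:~R); first by ring.
    by rewrite -cE; ring.
  rewrite mulrDr -!normrM E0 E1 !normrM -mulrDr ler_peMr//.
  rewrite -!intr_norm -intrD -[1]/(1%:~R) ler_int.
  exact: intvec_norm_ge1.
have Y0 : 0 <= Y by rewrite addr_ge0.
have [n1 hn1] := expr_unbounded (C * Y / `|g1 y| + 1) l1_gt1.
have [_ h _] := hz n1.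
have := hn1 _ (leq_addl N n1); apply/negP; rewrite -ltNge.
rewrite ltr_pwDr// ler_pdivlMr//.
have p0 : 0 <= `|l1| ^+ (N + n1) by rewrite exprn_ge0.
apply: le_trans (ler_wpM2l p0 (lower n1)) _.
by rewrite mulrA ler_wpM2r.
Qed.
End GoodScales.

(** * Eigenvalues *)

Section Spectrum.
Context {R : realType}.
Implicit Types (A P : 'M[R]_2).

Lemma norm_real_complex (x : R) : `|real_complex R x| = real_complex R `|x|.
Proof. by rewrite normc_def /= expr0n /= addr0 sqrtr_sqr. Qed.

Lemma char_poly_complexify A :
  char_poly (complexify A) = map_poly (real_complex R) (char_poly A).
Proof. by rewrite map_char_poly. Qed.

Lemma eigenvalues2_det A (l1 l2 : R[i]) : eigenvalues2 A l1 l2 -> l1 * l2 = real_complex R (\det A).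
Proof.
move=> heig; have := char_poly_det (complexify A).
rewrite -horner_coef0 heig !hornerE /= mulrNN det_map_mx.
by rewrite sqrrN expr1n mul1r.
Qed.

Lemma eigenvalues2_left A (l1 l2 : R[i]) : eigenvalues2 A l1 l2 ->
  exists2 f : 'rV[R[i]]_2, f *m complexify A = l1 *: f & f != 0.
Proof.
move=> heig; apply/eigenvalueP; rewrite eigenvalue_root_char heig.
by rewrite rootM root_XsubC eqxx.
Qed.

(** The values of the characteristic polynomial at 0 and 1 show that product and sum are real;
    eigenvalues that are not real are then conjugate, of equal modulus. *)
Lemma real_eigenvalues A (l1 l2 : R[i]) : eigenvalues2 A l1 l2 -> `|l1| != `|l2| ->
  exists r1 r2 : R, l1 = real_complex R r1 /\ l2 = real_complex R r2.
Proof.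
move=> heig; have hp := eigenvalues2_det heig.
have hs : (1 - l1) * (1 - l2) = real_complex R (char_poly A).[1].
  rewrite -horner_map /= -char_poly_complexify heig rmorph1.
  by rewrite hornerM !hornerXsubC.
case: l1 l2 {heig} hp hs => [x1 y1] [x2 y2] [_ h1] [_ h2] ne.
have e2 : y2 = - y1 by move: h1 h2; rewrite /=; lra.
have y10 : y1 = 0.
  apply/eqP; apply: contraNT ne => y10; apply/eqP.
  have e1 : x2 = x1.
    by apply: (mulIf y10); apply/eqP; rewrite -subr_eq0; apply/eqP; move: h1; rewrite e2; lra.
  by rewrite !normc_def /= e1 e2 sqrrN.
by exists x1, x2; rewrite e2 y10 oppr0.
Qed.

Lemma complex_left_eigenrow A (l1 l2 : R[i]) : eigenvalues2 A l1 l2 ->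
  exists u w : 'rV[R]_2, [/\ u *m A = complex.Re l1 *: u - complex.Im l1 *: w,
    w *m A = complex.Im l1 *: u + complex.Re l1 *: w & (u != 0) || (w != 0)].
Proof.
move=> /eigenvalues2_left[f fE f0].
exists (map_mx (@complex.Re R) f), (map_mx (@complex.Im R) f); split.
- apply/matrixP => i j; have := congr1 (fun M : 'rV_2 => complex.Re (M i j)) fE.
  rewrite !mulmx2E !mxE.
  by case: l1 fE => a b _; case: (f i 0) (f i 1) (f i j) => [? ?] [? ?] [? ?] /= <-; ring.
- apply/matrixP => i j; have := congr1 (fun M : 'rV_2 => complex.Im (M i j)) fE.
  rewrite !mulmx2E !mxE.
  case: l1 fE => a b _; case: (f i 0) (f i 1) (f i j) => [? ?] [? ?] [? ?] /=.
  by rewrite addrC => <-; ring.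
- apply: contraNT f0; rewrite negb_or !negbK => /andP[/eqP hu /eqP hw].
  apply/eqP/matrixP => i j; rewrite mxE; apply/eqP; rewrite eq_complex.
  have := congr1 (fun M : 'rV_2 => M i j) hu; have := congr1 (fun M : 'rV_2 => M i j) hw.
  by rewrite !mxE => -> ->; rewrite !eqxx.
Qed.

Lemma eigenrow_real A (r1 : R) (l2 : R[i]) : eigenvalues2 A (real_complex R r1) l2 ->
  exists2 f : 'rV[R]_2, f *m A = r1 *: f & f != 0.
Proof.
move=> heig; apply/eigenvalueP; rewrite -(@eigenvalue_map _ _ (real_complex R)).
by rewrite eigenvalue_root_char -/(complexify A) heig rootM root_XsubC eqxx.
Qed.

Lemma eigenvalues2_sym A (l1 l2 : R[i]) : eigenvalues2 A l1 l2 -> eigenvalues2 A l2 l1.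
Proof. by rewrite /eigenvalues2 mulrC. Qed.

(** Applying [A] to a proportionality between two eigenrows forces their eigenvalues to agree. *)
Lemma rows2_unit A (r1 r2 : R) (f1 f2 : 'rV[R]_2) :
  f1 *m A = r1 *: f1 -> f2 *m A = r2 *: f2 -> f1 != 0 -> f2 != 0 -> r1 != r2 ->
  rows2 f1 f2 \in unitmx.
Proof.
move=> f1E f2E f10 f20 r12; rewrite unitmxE unitfE det_rows2.
apply: contraNneq r12 => /eqP; rewrite subr_eq0 => /eqP d.
have [j f2j] : exists j, f2 0 j != 0.
  apply: contrapT => /forallNP n; case/eqP: f20; apply/matrixP => i j.
  by rewrite ord1 [RHS]mxE; apply/eqP/negPn/negP/n.
have e : f2 0 j *: f1 = f1 0 j *: f2.
  apply: eq_row2; rewrite !mxE; case: j f2j => -[|[|?]] // lj _.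
  - by rewrite (_ : Ordinal lj = 0) 1?mulrC//; exact/val_inj.
  - by rewrite (_ : Ordinal lj = 1) ?[f2 0 1 * _]mulrC ?d//; exact/val_inj.
  - by rewrite (_ : Ordinal lj = 0) ?[f2 0 0 * _]mulrC -?d//; exact/val_inj.
  - by rewrite (_ : Ordinal lj = 1) 1?mulrC//; exact/val_inj.
have := congr1 (mulmx^~ A) e; rewrite -!scalemxAl f1E f2E !scalerA ![_ * r1]mulrC ![_ * r2]mulrC.
rewrite -!scalerA -e => /eqP; rewrite -subr_eq0 -scalerBl scaler_eq0 subr_eq0.
by rewrite scaler_eq0 (negbTE f2j) (negbTE f10) !orbF.
Qed.

(* With r = f1 P, the eigenvector spans the kernel of r, so its slope is
   irrational exactly when r kills no nonzero integer vector. *)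
Lemma irrational_slopeP A P (r1 r2 : R) (f1 : 'rV[R]_2) (v : 'cV[R[i]]_2) :
  P \in unitmx -> f1 *m A = r1 *: f1 -> f1 != 0 -> r1 != r2 ->
  eigenvector (invmx P *m A *m P) (real_complex R r2) v ->
  (v 1 0 != 0 /\ exists2 r : R, irrational r & v 0 0 / v 1 0 = real_complex R r) <->
  (forall z : 'cV[int]_2, z != 0 -> (f1 *m lattice_pt P z) 0 0 != 0).
Proof.
move=> uP f1E f10 r12 [v0 vE]; pose c := f1 *m P.
have c0 : c != 0 by apply: contra_neq f10 => e; rewrite -[f1](mulmxK uP) -/c e mul0mx.
have g1E z : (f1 *m lattice_pt P z) 0 0 = c 0 0 * (z 0 0)%:~R + c 0 1 * (z 1 0)%:~R.
  by rewrite /lattice_pt mulmxA mulmx2E ![map_mx _ _ _ _]mxE.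
(* The left eigenvector [c] for [r1] and the right eigenvector [v] for [r2] of the same matrix are
   orthogonal, as the eigenvalues differ. *)
have cv : real_complex R (c 0 0) * v 0 0 + real_complex R (c 0 1) * v 1 0 = 0.
  have cE : c *m (invmx P *m A *m P) = r1 *: c.
    by rewrite /c -!mulmxA mulKVmx// mulmxA f1E scalemxAl.
  have := congr1 (mulmx (complexify c)) vE.
  rewrite mulmxA -map_mxM cE map_mxZ -scalemxAl -scalemxAr => /eqP.
  rewrite -subr_eq0 -scalerBl scaler_eq0 subr_eq0 => /orP[/eqP[]/eqP|/eqP].
    by rewrite (negbTE r12).
  by move=> /(congr1 (fun M : 'M[R[i]]_1 => M 0 0)); rewrite mulmx2E !mxE.
have c_or : c 0 0 = 0 -> c 0 1 != 0.
  by move=> e; apply: contra_neq c0 => e'; apply: eq_row2; rewrite [RHS]mxE.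
split.
  move=> [v10 [r irr rE]] z z0; rewrite g1E; apply/eqP => cz.
  have cr : c 0 0 * r + c 0 1 = 0.
    apply: (@complexI R); rewrite rmorphD rmorphM /= -rE rmorph0.
    by apply: (mulIf v10); rewrite mul0r -cv mulrDl -!mulrA mulVf// mulr1.
  have c00 : c 0 0 != 0.
    by apply/eqP => e; have := c_or e; move: cr; rewrite e mul0r add0r => ->; rewrite eqxx.
  have zr : (z 0 0)%:~R = r * (z 1 0)%:~R :> R.
    apply: (mulfI c00); apply/eqP; rewrite -subr_eq0; apply/eqP.
    transitivity (c 0 0 * (z 0 0)%:~R + c 0 1 * (z 1 0)%:~R
      - (c 0 0 * r + c 0 1) * (z 1 0)%:~R); first by ring.
    by rewrite cz cr mul0r subrr.
  have z10 : z 1 0 != 0.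
    apply: contra_neq z0 => z1; move: zr; rewrite z1 mulr0 => /eqP.
    by rewrite intr_eq0 => /eqP z00; apply: eq_mx2 => j; rewrite ord1 mxE.
  apply: irr; exists ((z 0 0)%:~R / (z 1 0)%:~R) => //.
  by rewrite fmorph_div /= !ratr_int zr mulfK// intr_eq0.
move=> irr; have v10 : v 1 0 != 0.
  apply/eqP => v1; have v00 : v 0 0 != 0.
    by apply: contra_neq v0 => e; apply: eq_mx2 => j; rewrite ord1 mxE.
  have /eqP := cv; rewrite v1 mulr0 addr0 mulf_eq0 (negbTE v00) orbF => /eqP[c00].
  have z0 : delta_mx 0 0 != 0 :> 'cV[int]_2.
    by apply/eqP => /matrixP /(_ 0 0); rewrite !mxE.
  by have := irr _ z0; rewrite g1E c00 !mxE /= mul0r mulr0 addr0 eqxx.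
have c00 : c 0 0 != 0.
  apply/eqP => e; have := c_or e; have /eqP := cv.
  by rewrite e mul0r add0r mulf_eq0 (negbTE v10) orbF => /eqP[->]; rewrite eqxx.
split => //; exists (- c 0 1 / c 0 0); last first.
  have cC : real_complex R (c 0 0) != 0 by rewrite fmorph_eq0.
  rewrite fmorph_div rmorphN /=; apply/eqP; rewrite eqr_div//; apply/eqP.
  by rewrite mulrC mulNr; apply/eqP; rewrite -addr_eq0 cv.
move=> [q _ qE].
(* A rational slope [q] gives the integer vector (numerator, denominator) in the kernel of [c]. *)
pose z : 'cV[int]_2 := \col_i (if i == 0 then numq q else denq q).
have z0 : z != 0.
  by apply/eqP => /matrixP /(_ 1 0); rewrite !mxE /= => /eqP; rewrite (negbTE (denq_neq0 q)).
have dq : (denq q)%:~R != 0 :> R by rewrite intr_eq0 denq_neq0.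
move/eqP: qE; rewrite /ratr eqr_div// => /eqP e.
by have := irr z z0; rewrite g1E ![z _ _]mxE /= mulrC e; rewrite mulNr addNr eqxx.
Qed.
End Spectrum.

(** * The unimodular, expanding and saddle cases assembled *)

Theorem theorem1p3 (R : realType) (A P : 'M[R]_2) (lambda1 lambda2 : R[i])
    (hA : A \in unitmx) (hdet : 1 <= `|\det A|) (hP : P \in unitmx)
    (heig : eigenvalues2 A lambda1 lambda2)
    (hle : `|lambda2| <= `|lambda1|) :
  [/\ `|lambda1 * lambda2| = 1 ->
        ~ exists T : set 'cV[R]_2, tiles_both T A P,
      1 < `|lambda1| -> 1 <= `|lambda2| ->
        exists T : set 'cV[R]_2, tiles_both T A P
    & 1 < `|lambda1 * lambda2| -> `|lambda2| < 1 ->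
        forall v : 'cV[R[i]]_2,
          eigenvector (invmx P *m A *m P) lambda2 v ->
          ((exists T : set 'cV[R]_2, tiles_both T A P) <->
           v 1 0 != 0 /\
           exists2 r : R, irrational r & v 0 0 / v 1 0 = real_complex R r)].
Proof.
have detE := eigenvalues2_det heig.
split.
- rewrite detE norm_real_complex => /(@complexI R _ 1) detA1 [S].
  move=> /(borel_tile hA hP)[T [mT packP coverP packA coverA]].
  exact: (unimodular_no_tile hA hP mT packP coverP packA coverA detA1).
- move=> h1 h2; have [delta delta0 good] := expanding_good hP heig h1 h2.
  have detA : 1 < `|\det A|.
    by rewrite -ltcR -norm_real_complex -detE normrM (lt_le_trans h1)// ler_peMr.
  have [u [w [uE wE uw]]] := complex_left_eigenrow heig.
  apply: (tiles_both_exist hA hP detA uE wE uw _ delta0) => [|n0].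
    have : 1 < `|lambda1| ^+ 2 by rewrite exprn_egt1.
    by rewrite -add_Re2_Im2 -[1]/(real_complex R 1) ltcR.
  by exists n0 => // z; exact: good.
move=> h12 h2 v hv.
have h1 : 1 < `|lambda1|.
  by apply: lt_le_trans h12 _; rewrite normrM ler_piMr// ltW.
have ne : `|lambda1| != `|lambda2| by rewrite gt_eqF// (lt_trans h2).
have [r1 [r2 [e1 e2]]] := real_eigenvalues heig ne.
rewrite {}e1 {}e2 in heig h1 h2 h12 hv detE ne * => {hle}.
have detr : \det A = r1 * r2 by apply: (@complexI R); rewrite rmorphM /= detE.
rewrite !norm_real_complex in h1 h2 ne.
rewrite detE norm_real_complex -[1]/(real_complex R 1) ltcR in h12.
rewrite -[1]/(real_complex R 1) ltcR in h1.
rewrite -[1]/(real_complex R 1) ltcR in h2.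
have r12 : r1 != r2 by apply: contra_neq ne => ->.
have [f1 f1E f10] := eigenrow_real heig.
have [f2 f2E f20] := eigenrow_real (eigenvalues2_sym heig).
have uM := rows2_unit f1E f2E f10 f20 r12.
apply: (iff_trans _ (iff_sym (irrational_slopeP hP f1E f10 r12 hv))).
split=> [[S /(borel_tile hA hP)[T [mT packP coverP packA coverA]]] z z0|irr].
  apply/eqP => f1z; have Pz0 : lattice_pt P z != 0.
    by rewrite -(lattice_pt0 P) (inj_eq (lattice_pt_inj hP)).
  (* Since [f1] kills the lattice vector, [f2] does not; dividing by [t] gives it the value 1
     there. *)
  set t := (f2 *m lattice_pt P z) 0 0; have t0 : t != 0.
    apply: contra_neq Pz0 => t0; rewrite -[LHS](mulKmx uM).
    suff -> : rows2 f1 f2 *m lattice_pt P z = 0 by rewrite mulmx0.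
    by apply: eq_mx2 => j; rewrite ord1 mulmx2E [RHS]mxE ![rows2 _ _ _ _]mxE /= -mulmx2E.
  have f2'E : (t^-1 *: f2) *m A = r2 *: (t^-1 *: f2).
    by rewrite -scalemxAl f2E !scalerA mulrC.
  have f2'0 : t^-1 *: f2 != 0 by rewrite scaler_eq0 invr_eq0 negb_or t0.
  have f2'z : (t^-1 *: f2 *m lattice_pt P z) 0 0 = 1 by rewrite -scalemxAl mxE mulVf.
  have dA : `|\det A| = `|r1 * r2| by rewrite detr.
  exact: (contracted_lattice_vector_no_tile hA mT (tile_finite hP mT packP) packP coverA
    f1E f1z f2'z (rows2_unit f1E f2'E f10 f2'0 r12) h1 h2 dA hdet).
(* For a real eigenvalue the imaginary parts [w] and [b] are 0; [saddle_good] provides delta = 1. *)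
apply: (@tiles_both_exist R A P f1 0 r1 0 1) => //.
- by rewrite f1E scale0r subr0.
- by rewrite mul0mx scale0r scaler0 addr0.
- by rewrite f10.
- by rewrite expr0n addr0 -(real_normK (num_real r1)) exprn_egt1.
- by apply: saddle_good hP f1E f2E uM h1 (ltW h2) _ irr; rewrite -detr.
Qed.
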